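(* Let $L$ be a finite-dimensional Lie algebra over a field of characteristic zero, and let $S$ be a finite-dimensional irreducible $L$-module. Then $$H^n(L/\operatorname{Ann}_L(S),S)=0$$ for every positive integer $n$.
   Context: $H^n(L,M)$ denotes the ordinary (Chevalley–Eilenberg) cohomology of a Lie algebra $L$ with coefficients in an $L$-module $M$. $\operatorname{Ann}_L(S):=\{x\in L\mid x\cdot s=0 \text{ for all } s\in S\}$, and $S$ is regarded as an $L/\operatorname{Ann}_L(S)$-module in the natural way. *)

(* Defs.v *)
From HB Require Import structures.
From mathcomp Require Import all_boot all_order all_algebra.
From mathcomp Require Import boolp functions.

Set Implicit Arguments.
Unset Strict Implicit.
Unset Printing Implicit Defensive.

Import GRing.Theory.
Import Quotient.

Local Open Scope ring_scope.
Local Open Scope quotient_scope.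

HB.mixin Record Lmodule_isLieAlgebra (F : fieldType) L of GRing.Lmodule F L := {
  bracket : L -> L -> L;
  bracket_linearl : forall y : L, linear (bracket^~ y);
  bracket_linearr : forall x : L, linear (bracket x);
  bracketxx : forall x : L, bracket x x = 0;
  bracket_jacobi : forall x y z : L,
    bracket x (bracket y z) + bracket y (bracket z x)
      + bracket z (bracket x y) = 0
}.

#[short(type="lieAlgType")]
HB.structure Definition LieAlgebra (F : fieldType) :=
  {L of Lmodule_isLieAlgebra F L & GRing.Lmodule F L}.

#[short(type="finLieAlgType")]
HB.structure Definition FinLieAlgebra (F : fieldType) :=
  {L of LieAlgebra F L & Vector F L}.

Section LieAlgebraTheory.
Variables (F : fieldType) (L : lieAlgType F).
Implicit Types x y z : L.

Lemma bracketDl x y z : bracket (x + y) z = bracket x z + bracket y z.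
Proof. by have := bracket_linearl z 1 x y; rewrite !scale1r. Qed.

Lemma bracketDr x y z : bracket x (y + z) = bracket x y + bracket x z.
Proof. by have := bracket_linearr x 1 y z; rewrite !scale1r. Qed.

Lemma bracketBl x y z : bracket (x - y) z = bracket x z - bracket y z.
Proof. exact: (zmod_morphism_linear (bracket_linearl z)). Qed.

Lemma bracketBr x y z : bracket x (y - z) = bracket x y - bracket x z.
Proof. exact: (zmod_morphism_linear (bracket_linearr x)). Qed.

Lemma bracketC x y : bracket x y = - bracket y x.
Proof.
apply/eqP; rewrite -addr_eq0; apply/eqP.
have := bracketxx (x + y).
by rewrite bracketDl !bracketDr !bracketxx add0r addr0.
Qed.

End LieAlgebraTheory.

Record lieAction (F : fieldType) (L : lieAlgType F) (M : lmodType F) :=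
  LieAction {
    lie_act :> L -> M -> M;
    lie_act_linearl : forall m, linear (lie_act^~ m);
    lie_act_linearr : forall x, linear (lie_act x);
    lie_act_bracket : forall x y m,
      lie_act (bracket x y) m = lie_act x (lie_act y m) - lie_act y (lie_act x m)
  }.

Definition irreducible (F : fieldType) (L : lieAlgType F) (S : vectType F)
    (rho : lieAction L S) : Prop :=
  (fullv : {vspace S}) != 0%VS /\
  forall U : {vspace S},
    (forall x u, u \in U -> rho x u \in U) -> U = 0%VS \/ U = fullv.

Record subspace (F : fieldType) (V : lmodType F) := Subspace {
  subspace_pred :> {pred V};
  subspace_closed : submod_closed subspace_pred
}.

HB.instance Definition _ (F : fieldType) (V : lmodType F) (U : subspace V) :=
  GRing.isSubmodClosed.Build F V (subspace_pred U)
    (GRing.submod_closed_semi (subspace_closed U)).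

Section QuotientSpace.
Variables (F : fieldType) (V : lmodType F) (U : subspace V).

Definition quotient_space : Type := {quot subspace_pred U}.

HB.instance Definition _ := GRing.Zmodule.on quotient_space.
HB.instance Definition _ :=
  ZmodQuotient.copy quotient_space {quot subspace_pred U}.

Implicit Types (a b : F) (x y : quotient_space).

Definition quot_scale a : quotient_space -> quotient_space :=
  lift_op1 quotient_space ( *:%R a).

Lemma quot_eqP (u v : V) :
  reflect (u = v %[mod quotient_space]) (u - v \in subspace_pred U).
Proof. by rewrite [_ \in _]Quotient.idealrBE; apply: eqP. Qed.

Lemma pi_scale a : {morph \pi_quotient_space : u / a *: u >-> quot_scale a u}.
Proof.
move=> u; unlock quot_scale; apply/quot_eqP.
by rewrite -scalerBr rpredZ //; apply/quot_eqP; rewrite reprK.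
Qed.

Lemma quot_scalerA a b x : quot_scale a (quot_scale b x) = quot_scale (a * b) x.
Proof. by rewrite -[x]reprK -!pi_scale scalerA. Qed.

Lemma quot_scale1r : left_id 1 quot_scale.
Proof. by move=> x; rewrite -[x]reprK -pi_scale scale1r. Qed.

Lemma quot_scalerDr : right_distributive quot_scale +%R.
Proof.
move=> a; elim/quotW=> u; elim/quotW=> v.
by rewrite -raddfD -!pi_scale scalerDr raddfD.
Qed.

Lemma quot_scalerDl x : {morph quot_scale^~ x : a b / a + b}.
Proof. by move=> a b; elim/quotW: x => u; rewrite -!pi_scale scalerDl raddfD. Qed.

HB.instance Definition _ := GRing.Zmodule_isLmodule.Build F quotient_space
  quot_scalerA quot_scale1r quot_scalerDr quot_scalerDl.

Lemma pi_linear : linear (\pi_quotient_space : V -> quotient_space).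
Proof. by move=> a u v; rewrite raddfD /= pi_scale. Qed.

End QuotientSpace.

Record lieIdeal (F : fieldType) (L : lieAlgType F) := LieIdeal {
  ideal_space :> subspace L;
  ideal_bracket : forall x u, u \in ideal_space -> bracket x u \in ideal_space
}.

Section QuotientLieAlgebra.
Variables (F : fieldType) (L : lieAlgType F) (I : lieIdeal L).

Definition lie_quotient : Type := quotient_space I.

HB.instance Definition _ := GRing.Lmodule.on lie_quotient.
HB.instance Definition _ := ZmodQuotient.copy lie_quotient (quotient_space I).

Implicit Types x y z : lie_quotient.

Definition quot_bracket : lie_quotient -> lie_quotient -> lie_quotient :=
  lift_op2 lie_quotient bracket.

Lemma lie_quot_eqP (u v : L) :
  reflect (u = v %[mod lie_quotient]) (u - v \in subspace_pred I).
Proof. exact: quot_eqP. Qed.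

Lemma lie_pi_linear : linear (\pi_lie_quotient : L -> lie_quotient).
Proof. exact: pi_linear. Qed.


Lemma pi_bracket :
  {morph \pi_lie_quotient : u v / bracket u v >-> quot_bracket u v}.
Proof.
move=> u v; unlock quot_bracket; apply/lie_quot_eqP.
set u' := repr _; set v' := repr _.
have uu' : u - u' \in subspace_pred I by apply/lie_quot_eqP; rewrite reprK.
have vv' : v - v' \in subspace_pred I by apply/lie_quot_eqP; rewrite reprK.
have -> : bracket u v - bracket u' v' = bracket u (v - v') - bracket v' (u - u').
  rewrite !bracketBr [bracket v' u]bracketC [bracket v' u']bracketC.
  by rewrite !opprK opprD opprK addrA subrK.
by rewrite rpredB // ideal_bracket.
Qed.

Lemma quot_bracket_linearl y : linear (quot_bracket^~ y).
Proof.
elim/quotW: y => w a; elim/quotW=> u; elim/quotW=> v.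
by rewrite -lie_pi_linear -!pi_bracket bracket_linearl lie_pi_linear.
Qed.

Lemma quot_bracket_linearr x : linear (quot_bracket x).
Proof.
elim/quotW: x => w a; elim/quotW=> u; elim/quotW=> v.
by rewrite -lie_pi_linear -!pi_bracket bracket_linearr lie_pi_linear.
Qed.

Lemma quot_bracketxx x : quot_bracket x x = 0.
Proof. by elim/quotW: x => u; rewrite -pi_bracket bracketxx raddf0. Qed.

Lemma quot_bracket_jacobi x y z :
  quot_bracket x (quot_bracket y z) + quot_bracket y (quot_bracket z x)
    + quot_bracket z (quot_bracket x y) = 0.
Proof.
elim/quotW: x => u; elim/quotW: y => v; elim/quotW: z => w.
by rewrite -!pi_bracket -!raddfD bracket_jacobi raddf0.
Qed.

HB.instance Definition _ := Lmodule_isLieAlgebra.Build F lie_quotient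
  quot_bracket_linearl quot_bracket_linearr quot_bracketxx quot_bracket_jacobi.

End QuotientLieAlgebra.

Section Annihilator.
Variables (F : fieldType) (L : lieAlgType F) (M : lmodType F).
Variable rho : lieAction L M.

Lemma lie_act0l m : rho 0 m = 0.
Proof.
by have := lie_act_linearl rho m (-1) 0 0; rewrite scaler0 addr0 scaleN1r addNr.
Qed.

Lemma lie_act0r x : rho x 0 = 0.
Proof.
by have := lie_act_linearr rho x (-1) 0 0; rewrite scaler0 addr0 scaleN1r addNr.
Qed.

Definition annihilator_pred : {pred L} := fun x => `[< forall m, rho x m = 0 >].

Lemma annihilatorP x : reflect (forall m, rho x m = 0) (x \in annihilator_pred).
Proof. exact: asboolP. Qed.

Lemma annihilator_closed : submod_closed annihilator_pred.
Proof.
split=> [|a x y /annihilatorP x0 /annihilatorP y0]; apply/annihilatorP=> m.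
  exact: lie_act0l.
by rewrite lie_act_linearl x0 y0 scaler0 addr0.
Qed.

Lemma annihilator_bracket x u :
  u \in Subspace annihilator_closed ->
  bracket x u \in Subspace annihilator_closed.
Proof.
move=> /annihilatorP u0; apply/annihilatorP=> m.
by rewrite lie_act_bracket !u0 lie_act0r subr0.
Qed.

Definition annihilator : lieIdeal L := LieIdeal annihilator_bracket.

Definition quot_act (x : lie_quotient annihilator) (m : M) : M := rho (repr x) m.

Lemma quot_actE u m : quot_act (\pi_(lie_quotient annihilator) u) m = rho u m.
Proof.
have /lie_quot_eqP/annihilatorP/(_ m) :
    repr (\pi_(lie_quotient annihilator) u) = u %[mod lie_quotient annihilator] by rewrite reprK.
rewrite (zmod_morphism_linear (lie_act_linearl rho m)).
by move/eqP; rewrite subr_eq0 => /eqP.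
Qed.

Lemma quot_act_linearl m : linear (quot_act^~ m).
Proof.
move=> a; elim/quotW=> u; elim/quotW=> v.
by rewrite -lie_pi_linear !quot_actE lie_act_linearl.
Qed.

Lemma quot_act_linearr x : linear (quot_act x).
Proof. exact: lie_act_linearr. Qed.

Lemma quot_act_bracket x y m :
  quot_act (bracket x y) m =
  quot_act x (quot_act y m) - quot_act y (quot_act x m).
Proof.
elim/quotW: x => u; elim/quotW: y => v.
by rewrite -[bracket _ _]pi_bracket !quot_actE lie_act_bracket.
Qed.

Definition quot_action : lieAction (lie_quotient annihilator) M :=
  LieAction quot_act_linearl quot_act_linearr quot_act_bracket.

End Annihilator.

Section Cochains.
Variables (F : fieldType) (L : lieAlgType F) (M : lmodType F) (n : nat).
Implicit Types (v : {ffun 'I_n -> L}) (f : {ffun 'I_n -> L} -> M).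

Definition set_arg v (i : 'I_n) (x : L) : {ffun 'I_n -> L} :=
  [ffun j => if j == i then x else v j].

Definition multilinear f : Prop :=
  forall v i, linear (fun x => f (set_arg v i x)).

Definition alternating f : Prop :=
  forall v (i j : 'I_n), i != j -> v i = v j -> f v = 0.

Definition cochain_pred : {pred {ffun 'I_n -> L} -> M} :=
  fun f => `[< multilinear f /\ alternating f >].

Lemma cochain_closed : submod_closed cochain_pred.
Proof.
split=> [|a f g /asboolP[fl fa] /asboolP[gl ga]]; apply/asboolP; split.
- by move=> v i b x y; rewrite /= scaler0 addr0.
- by [].
- move=> v i b x y /=; rewrite !fctE fl gl !scalerDr !scalerA mulrC.
  by rewrite addrACA.
- by move=> v i j ij vij; rewrite !fctE (fa v i j) // (ga v i j) // scaler0 addr0.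
Qed.

HB.instance Definition _ :=
  GRing.isSubmodClosed.Build F ({ffun 'I_n -> L} -> M) cochain_pred
    (GRing.submod_closed_semi cochain_closed).

Record cochain := Cochain {
  cochain_fun :> {ffun 'I_n -> L} -> M;
  _ : cochain_fun \in cochain_pred
}.

HB.instance Definition _ := [isSub for cochain_fun].
HB.instance Definition _ := [Choice of cochain by <:].
HB.instance Definition _ := [SubChoice_isSubLmodule of cochain by <:].

End Cochains.

Section Cohomology.
Variables (F : fieldType) (L : lieAlgType F) (M : lmodType F).
Variable rho : lieAction L M.

(* With 0-based indices,
     df(v_0,...,v_n) =
       sum_i (-1)^i v_i . f(v_0,..,^v_i,..,v_n)
       + sum_(i<j) (-1)^(i+j) f([v_i,v_j],v_0,..,^v_i,..,^v_j,..,v_n). *)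
Definition CE_diff n (f : {ffun 'I_n -> L} -> M) (v : {ffun 'I_n.+1 -> L}) : M :=
  \sum_(i < n.+1) (-1) ^+ i *: rho (v i) (f [ffun k : 'I_n => v (lift i k)])
  + \sum_(i < n.+1) \sum_(j < n.+1 | (i < j)%N) (-1) ^+ (i + j) *:
      f [ffun k : 'I_n =>
           nth 0 (bracket (v i) (v j)
                    :: [seq v l | l <- enum 'I_n.+1 & (l != i) && (l != j)]) k].

Lemma CE_diff_linear n : linear (@CE_diff n).
Proof.
move=> a f g; apply/funext=> v; rewrite /CE_diff !fctE scalerDr addrACA.
congr (_ + _).
  rewrite scaler_sumr -big_split; apply: eq_bigr => i _ /=.
  by rewrite lie_act_linearr scalerDr !scalerA mulrC.
rewrite scaler_sumr -big_split; apply: eq_bigr => i _ /=.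
rewrite scaler_sumr -big_split; apply: eq_bigr => j _ /=.
by rewrite scalerDr !scalerA mulrC.
Qed.

Lemma CE_diff0 n : @CE_diff n 0 = 0.
Proof.
by have := @CE_diff_linear n (-1) 0 0; rewrite scaler0 addr0 scaleN1r addNr.
Qed.

Definition cocycle_pred n : {pred cochain L M n} :=
  fun f => `[< CE_diff f = 0 >].

Lemma cocycle_closed n : submod_closed (@cocycle_pred n).
Proof.
split=> [|a f g /asboolP f0 /asboolP g0]; apply/asboolP; first exact: CE_diff0.
by rewrite [LHS](CE_diff_linear a f g) f0 g0 scaler0 addr0.
Qed.

HB.instance Definition _ n :=
  GRing.isSubmodClosed.Build F (cochain L M n) (@cocycle_pred n)
    (GRing.submod_closed_semi (@cocycle_closed n)).

Record cocycle n := Cocycle {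
  cocycle_cochain :> cochain L M n;
  _ : cocycle_cochain \in @cocycle_pred n
}.

HB.instance Definition _ n := [isSub for @cocycle_cochain n].
HB.instance Definition _ n := [Choice of cocycle n by <:].
HB.instance Definition _ n := [SubChoice_isSubLmodule of cocycle n by <:].

Definition is_coboundary n : cocycle n -> Prop :=
  match n with
  | 0 => fun f => f = 0
  | m.+1 => fun f => exists g : cochain L M m, CE_diff g = f
  end.

Definition coboundary_pred n : {pred cocycle n} :=
  fun f => `[< is_coboundary f >].

Lemma coboundary_closed n : submod_closed (@coboundary_pred n).
Proof.
case: n => [|n]; split=> [|a f g /asboolP].
- exact/asboolP.
- by move=> -> /asboolP ->; apply/asboolP; rewrite scaler0 addr0.
- by apply/asboolP; exists 0; exact: CE_diff0.
move=> [f' ff'] /asboolP[g' gg']; apply/asboolP; exists (a *: f' + g').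
by rewrite [LHS](CE_diff_linear a f' g') ff' gg'.
Qed.

(* B^n is carved out of Z^n as the cocycles lying in the image of d; since
   d o d = 0 that is all of im d, so the quotient below is ker d / im d. *)
Definition coboundary n : subspace (cocycle n) :=
  Subspace (@coboundary_closed n).

Definition cohomology n : Type := quotient_space (coboundary n).

HB.instance Definition _ n := GRing.Lmodule.on (cohomology n).

End Cohomology.

(* Main.v *)
Require Import Defs.
From HB Require Import structures.
From mathcomp Require Import all_boot all_order all_algebra.
From mathcomp Require Import falgebra fieldext boolp functions.

(** The quotient of L by the annihilator acts faithfully and irreducibly on S,
    so it is a matrix Lie algebra G with no proper nonzero invariant subspace.
    Everything rests on an invariant tensor for G, that is, a sum of e_i (x) A_i
    with e_i in G and A_i an endomorphism of S, fixed by the adjoint action,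
    such that C = sum_i A_i e_i is nonzero.  Given such a tensor, sending a
    cochain f to sum_i A_i f(e_i, ...) is a homotopy between the cochain map
    induced by C and the zero map in positive degrees ([CE_diff_homotopy],
    which follows from the formula [CE_diff_fcons] relating the differential
    to the insertion of a first argument).  The endomorphism C commutes with
    the action, hence is invertible by Schur's argument
    ([invariant_tensor_unit]), and every cocycle of positive degree is a
    coboundary ([cohomology_eq0]).  If G = 0 there is nothing to prove, as
    cochains of positive degree vanish.

    The tensor exists for one of two reasons ([exists_invariant_tensor]).
    If G has a nonzero central element z, take z (x) 1.  Otherwise the form
    tr(ab) is nondegenerate on G, and the Casimir tensor of a basis and its
    dual basis is invariant; the trace of C is then dim G, which is nonzero in
    characteristic zero.

    That a G without nonzero central elements has nondegenerate trace form is
    the substance of the proof ([central_or_nondegenerate]).  Let R be the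
    radical of the form, an ideal of G.  Cartan's argument ([nilpotent_of_trace]) shows that every
    element of [R,G] is nilpotent; by Engel's theorem ([engel]) the ideal [R,G]
    has a common null vector, the null vectors form a G-submodule, so they fill
    the whole space and [R,G] = 0: R is central.

    For Cartan's argument, pass to a field where x in [R,G] has eigenvalues
    l_1, ..., l_m, and let phi in Q^m be orthogonal to all rational linear
    relations between the l_i.  By interpolation there are polynomials p and P
    with [p(x), b] = P(ad x) b for all b, where p(l_i) = phi_i and P(0) = 0
    ([additive_functional_calculus]).  As x is in [R,G] and ad x maps G to R,
    this gives 0 = tr(x p(x)) = sum_i l_i phi_i, so phi is itself one of the
    relations to which it is orthogonal; hence phi = 0 by positivity of the sum
    of squares over Q, and all l_i vanish
    ([eq0_of_rational_functionals]). *)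

Set Implicit Arguments.
Unset Strict Implicit.
Unset Printing Implicit Defensive.

Import Order.TTheory GRing.Theory Num.Theory.
Import FalgLfun VectorInternalTheory.
Local Open Scope ring_scope.
Local Open Scope quotient_scope.

(** * Induction on subspaces *)

Lemma dimv_strict_ind (F : fieldType) (V : vectType F) (P : {vspace V} -> Prop) :
    (forall U, (forall W, (\dim U < \dim W)%N -> P W) -> P U) ->
  forall U, P U.
Proof.
move=> IH U; have [k] := ubnP (\dim {:V} - \dim U).
elim: k U => // k IHk U Uk; apply: IH => W UW; apply: IHk.
apply: leq_trans _ (ltnSE Uk); apply: ltn_sub2l => //.
exact: leq_trans UW (dimvS (subvf W)).
Qed.

Lemma dimv_ltS (F : fieldType) (V : vectType F) (U W : {vspace V}) v :
  {subset U <= W} -> v \in W -> v \notin U -> (\dim U < \dim W)%N.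
Proof.
move=> /subvP UW vW vU; rewrite ltn_neqAle dimvS // andbT.
by apply: contraNneq vU => dU; have /eqP-> : (U == W)%VS by rewrite eqEdim UW dU /=.
Qed.

(** Finite dimension makes every linear condition, even an undecidable one,
    define a subspace in the sense of [{vspace V}]: enlarge a subspace of
    solutions until it contains all of them. *)
Lemma vspace_of_pred (F : fieldType) (V : vectType F) (P : V -> Prop) :
    P 0 -> (forall a u v, P u -> P v -> P (a *: u + v)) ->
  exists U : {vspace V}, forall v, v \in U <-> P v.
Proof.
move=> P0 PD.
suff H (U : {vspace V}) : (forall v, v \in U -> P v) ->
    exists U : {vspace V}, forall v, v \in U <-> P v.
  by apply: (H 0%VS) => v; rewrite memv0 => /eqP->.
elim/dimv_strict_ind: U => U IHU UP.
have [PU|/existsNP[v /not_implyP[Pv /negP vU]]] := pselect (forall v, P v -> v \in U).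
  by exists U => v; split; [exact: UP | exact: PU].
apply: (IHU (U + <[v]>)%VS) => [|w /memv_addP[u uU [_ /vlineP[a ->] ->]]].
  apply: dimv_ltS vU; first exact/subvP/addvSl.
  by rewrite (subvP (addvSr _ _)) ?memv_line.
by rewrite addrC; apply: PD => //; exact: UP.
Qed.


(** * Traces of powers of a matrix with split characteristic polynomial *)

Lemma char_poly_conj (R : comUnitRingType) n (g x : 'M[R]_n) :
  g \in unitmx -> char_poly (g *m x *m invmx g) = char_poly x.
Proof.
move=> gU; rewrite /char_poly /char_poly_mx !map_mxM.
have gP : map_mx polyC g *m map_mx polyC (invmx g) = 1%:M.
  by rewrite -map_mxM mulmxV // map_mx1.
have -> : 'X%:M - map_mx polyC g *m map_mx polyC x *m map_mx polyC (invmx g)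
   = map_mx polyC g *m ('X%:M - map_mx polyC x) *m map_mx polyC (invmx g).
  rewrite mulmxBr mulmxBl; congr (_ - _).
  by rewrite scalar_mxC -mulmxA gP mulmx1.
by rewrite !det_mulmx mulrAC -det_mulmx gP det1 mul1r.
Qed.

Lemma exp_conjmx (R : comUnitRingType) n (g x : 'M[R]_n) k :
  g \in unitmx -> (g *m x *m invmx g) ^+ k = g *m x ^+ k *m invmx g.
Proof.
move=> gU; elim: k => [|k IHk]; first by rewrite !expr0 mulmx1 mulmxV.
rewrite !exprS IHk -!mulmxE !mulmxA; congr (_ *m _ *m _).
by rewrite mulmxKV.
Qed.

Lemma exp_lblock_mx (R : comPzRingType) n1 n2 (a : 'M[R]_n1) (b : 'M[R]_(n2, n1))
    (d : 'M[R]_n2) k :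
  exists c, block_mx a 0 b d ^+ k = block_mx (a ^+ k) 0 c (d ^+ k).
Proof.
elim: k => [|k [c IHk]]; first by exists 0; rewrite !expr0 -scalar_mx_block.
exists (b *m a ^+ k + d *m c); rewrite !exprS IHk -mulmxE mulmx_block.
by rewrite !mul0mx !mulmx0 !addr0 add0r !mulmxE.
Qed.

Lemma char_poly_lblock_mx (R : comNzRingType) n1 n2 (a : 'M[R]_n1)
    (b : 'M[R]_(n2, n1)) (d : 'M[R]_n2) :
  char_poly (block_mx a 0 b d) = char_poly a * char_poly d.
Proof.
rewrite /char_poly /char_poly_mx map_block_mx (@scalar_mx_block _ n1 n2).
by rewrite opp_block_mx add_block_mx map_mx0 subr0 det_lblock.
Qed.

(** Complete an eigenvector to a basis in which it comes first. *)
Lemma eigenvector_block_mx (K : fieldType) n (x : 'M[K]_(1 + n)) l :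
  eigenvalue x l ->
  exists g b d, g \in unitmx /\
    g *m x *m invmx g = block_mx (l%:M : 'M_1) 0 b d.
Proof.
case/eigenvalueP=> v vx v0.
pose e : 'rV[K]_(1 + n) := delta_mx 0 0.
pose f : 'M[K]_(1 + n) := delta_mx 0 (0 : 'I_1) *m v.
have ef : e *m f = v by rewrite mulmxA mul_delta_mx (mx11_scalar (delta_mx _ _)) mxE mul1mx.
have [|g gU eg] := @complete_unitmx _ _ _ e f.
  by rewrite ef !rank_rV v0 /e; case: eqP => // /matrixP/(_ 0 0)/eqP; rewrite !mxE oner_eq0.
rewrite ef in eg; pose B := g *m x *m invmx g.
have eB : e *m B = l *: e.
  by rewrite !mulmxA -eg vx -scalemxAl eg mulmxK.
exists g, (dlsubmx B), (drsubmx B); split=> //.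
rewrite -/B -[LHS](@submxK _ 1 n 1 n).
suff: usubmx B = l *: e.
  move=> uB; congr block_mx; rewrite /ulsubmx /ursubmx uB; apply/matrixP=> i j.
    by rewrite !ord1 !mxE eqxx andbT !mulr1.
  by rewrite !mxE (_ : rshift 1 j == 0 = false) ?andbF ?mulr0.
rewrite -eB; apply/rowP=> j; rewrite -rowE mxE [RHS]mxE.
by congr (B _ _); apply: val_inj.
Qed.

(** Triangularisation, one eigenvector at a time: splitting off an eigenvalue
    leaves a smaller diagonal block whose characteristic polynomial has the
    remaining roots. *)
Lemma mxtrace_exp_roots (K : fieldType) n (x : 'M[K]_n) (r : seq K) :
  char_poly x = \prod_(l <- r) ('X - l%:P) ->
  forall k, \tr (x ^+ k) = \sum_(l <- r) l ^+ k.
Proof.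
elim: n x r => [|n IHn] x r rx k.
  have := size_char_poly x; rewrite rx size_prod_XsubC => -[/size0nil->].
  by rewrite big_nil /mxtrace big_ord0.
have := size_char_poly x; rewrite rx size_prod_XsubC.
case: r rx => // l r rx [szr].
have /(@eigenvector_block_mx _ n)[g [b [d [gU gx]]]] : eigenvalue x l.
  by rewrite eigenvalue_root_char rx big_cons rootM root_XsubC eqxx.
have := char_poly_conj x gU; rewrite gx => E.
have {E} := etrans (esym (char_poly_lblock_mx _ b d)) E; rewrite rx big_cons.
rewrite {1}/char_poly det_mx11 !mxE mulr1n => /mulfI rd.
have {rd} /IHn/(_ k) rd : char_poly d = \prod_(l <- r) ('X - l%:P).
  by apply: rd; rewrite polyXsubC_eq0.
have [c] := exp_lblock_mx (l%:M : 'M_1) b d k; rewrite -gx exp_conjmx //.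
move/(congr1 mxtrace); rewrite mxtrace_mulC mulmxA mulVmx // mul1mx => ->.
rewrite mxtrace_block rd big_cons; congr (_ + _).
elim: k {rd} => [|k IHk]; first by rewrite !expr0 mxtrace1.
rewrite !exprS -mulmxE mul_scalar_mx mxtraceZ; congr (_ * _); exact: IHk.
Qed.

(** * Splitting fields and Hermite interpolation *)

(** If p is not irreducible, a root of a proper divisor is a root of p. *)
Lemma root_extension (F : fieldType) (p : {poly F}) : (1 < size p)%N ->
  exists (K : fieldType) (f : {rmorphism F -> K}) (z : K), root (map_poly f p) z.
Proof.
have [m] := ubnP (size p); elim: m p => // m IHm p /ltnSE pm p1.
have [pirr|/existsNP[q]] := pselect (forall q : {poly F}, size q != 1 -> q %| p -> q %= p).
  by have [K _ [z zp _]] := irredp_FAdjoin (conj p1 pirr); exists K, (in_alg K), z.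
move=> /not_implyP[q1 /not_implyP[qp qNp]].
have p0 : p != 0 by rewrite -size_poly_gt0 ltnW.
have q0 : q != 0 by apply: contraNneq p0 => q0; rewrite q0 dvd0p in qp.
have szq : (size q < size p)%N.
  by rewrite ltn_neqAle dvdp_leq // andbT dvdp_size_eqp //; apply/negP.
have [||K [f [z zq]]] := IHm q; first exact: leq_trans szq pm.
  by rewrite ltn_neqAle eq_sym q1 size_poly_gt0.
by exists K, f, z; apply: root_dvdp zq; rewrite dvdp_map.
Qed.

Lemma splitting_extension (F : fieldType) (p : {poly F}) : p \is monic ->
  exists (K : fieldType) (f : {rmorphism F -> K}) (r : seq K),
    map_poly f p = \prod_(l <- r) ('X - l%:P).
Proof.
have [m] := ubnP (size p); elim: m F p => // m IHm F p /ltnSE pm pmon.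
have [p1|p1] := leqP (size p) 1.
  exists F, idfun, [::]; rewrite big_nil map_polyE map_id polyseqK.
  by have /size1_polyC pC := p1; move: pmon; rewrite pC monicE lead_coefC => /eqP->.
have [K [f [z /factor_theorem[q pq]]]] := root_extension p1.
have qmon : q \is monic.
  by rewrite -(monicMr q (monicXsubC z)) -pq map_monic.
have szq : size p = (size q).+1.
  by rewrite -(size_map_poly f) pq size_Mmonic ?monicXsubC ?monic_neq0 // size_XsubC addn2.
have [|K' [f' [r qr]]] := IHm K q _ qmon; first by rewrite -szq.
exists K', (f' \o f), (f' z :: r).
rewrite map_poly_comp pq rmorphM /= qr big_cons mulrC; congr (_ * _).
by rewrite rmorphB /= map_polyX map_polyC.
Qed.

Lemma coprimep_XsubC_exp_prod (K : fieldType) N (z : K) (s : seq K) : z \notin s ->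
  coprimep (('X - z%:P) ^+ N) (\prod_(t <- s) ('X - t%:P) ^+ N).
Proof.
elim: s => [|t s IHs]; first by rewrite big_nil coprimep1.
rewrite in_cons negb_or big_cons => /andP[zt /IHs zs].
rewrite coprimepMr zs andbT coprimep_expl // coprimep_expr //.
by apply: coprimep_XsubC2; rewrite subr_eq0 eq_sym.
Qed.

(** A polynomial that agrees to order N with prescribed constants at finitely
    many points; it is the Chinese remainder theorem for the powers of the
    [X - t], one point being added at a time by a Bezout relation. *)
Lemma hermite_interpolation (K : fieldType) N (s : seq K) (c : K -> K) :
  exists P : {poly K}, forall t, t \in s -> ('X - t%:P) ^+ N %| P - (c t)%:P.
Proof.
elim: s => [|z s [P sP]]; first by exists 0.
have [zs|zs] := boolP (z \in s).
  by exists P => t; rewrite in_cons => /predU1P[->|]; exact: sP.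
have /Bezout_eq1_coprimepP[[u v] /= uv] := coprimep_XsubC_exp_prod N zs.
set A := ('X - z%:P) ^+ N in uv; set B := \prod_(t <- s) _ in uv.
exists (P + ((c z)%:P - P) * (v * B)) => t; rewrite in_cons => /predU1P[->|ts].
  have -> : v * B = 1 - u * A by rewrite -uv addrC addKr.
  rewrite mulrBr mulr1 addrA subrKC addrAC subrr sub0r.
  by rewrite dvdpNr mulrA dvdp_mull.
rewrite addrAC dvdp_add ?sP // !mulrA dvdp_mull //.
by rewrite /B (big_rem t) //= dvdp_mulr.
Qed.

(** * Rational functionals in characteristic zero *)

Section RatrChar0.
Variables (K : fieldType) (charK : [pchar K] =i pred0).

Lemma intr_eq0_char0 (z : int) : (z%:~R == 0 :> K) = (z == 0).
Proof.
by case: z => m; rewrite ?NegzE ?rmorphN ?oppr_eq0 /= -?pmulrn ?(pcharf0P _).1.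
Qed.

(** Any fraction representing q computes its image, since nonzero integers
    remain nonzero in K. *)
Lemma ratr_eq (q : rat) (m d : int) : d != 0 -> q = m%:~R / d%:~R ->
  ratr q = m%:~R / d%:~R :> K.
Proof.
move=> d0 qE; have dK : d%:~R != 0 :> K by rewrite intr_eq0_char0.
have dQ : d%:~R != 0 :> rat by rewrite intr_eq0.
have nK : (denq q)%:~R != 0 :> K by rewrite intr_eq0_char0 denq_neq0.
have nQ : (denq q)%:~R != 0 :> rat by rewrite intr_eq0 denq_neq0.
apply/eqP; rewrite /ratr eqr_div // -!intrM.
suff -> : numq q * d = m * denq q by [].
apply/eqP; rewrite -(eqr_int rat) !intrM -eqr_div //.
by rewrite divq_num_den -qE.
Qed.

Lemma ratrD_char0 (p q : rat) : ratr (p + q) = ratr p + ratr q :> K.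
Proof.
have nK r : (denq r)%:~R != 0 :> K by rewrite intr_eq0_char0 denq_neq0.
have nQ r : (denq r)%:~R != 0 :> rat by rewrite intr_eq0 denq_neq0.
rewrite (@ratr_eq _ (numq p * denq q + numq q * denq p) (denq p * denq q)).
- by rewrite /ratr addf_div // !intrD !intrM.
- by rewrite mulf_neq0 ?denq_neq0.
by rewrite !intrD !intrM -addf_div // !divq_num_den.
Qed.

Lemma ratrM_char0 (p q : rat) : ratr (p * q) = ratr p * ratr q :> K.
Proof.
rewrite (@ratr_eq _ (numq p * numq q) (denq p * denq q)).
- by rewrite /ratr mulf_div // !intrM.
- by rewrite mulf_neq0 ?denq_neq0.
by rewrite !intrM -mulf_div !divq_num_den.
Qed.

Lemma rat_embedding : inhabited {rmorphism rat -> K}.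
Proof.
have rB : zmod_morphism (ratr : rat -> K).
  by move=> p q; apply/eqP; rewrite eq_sym subr_eq -ratrD_char0 subrK.
have rM : monoid_morphism (ratr : rat -> K) by split; [exact: (ratr_nat K 1) | exact: ratrM_char0].
pose zM := GRing.isZmodMorphism.Build rat K ratr rB.
pose mM := GRing.isMonoidMorphism.Build rat K ratr rM.
by constructor; exact: (HB.pack (ratr : rat -> K) zM mM).
Qed.

End RatrChar0.

(** The positivity argument at the heart of Cartan's criterion.  The relations
    [\sum_i c_i l_i = 0] with rational c form a subspace U of Q^m.  The
    hypothesis says that every phi orthogonal to U lies in U, so that phi is
    orthogonal to itself and vanishes.  Hence U is everything, and the unit
    vectors in U say that each l_i is zero. *)
Lemma eq0_of_rational_functionals (K : fieldType) (f : {rmorphism rat -> K})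
    m (l : 'I_m -> K) :
    (forall phi : 'I_m -> rat,
      (forall c : 'I_m -> rat, \sum_i f (c i) * l i = 0 -> \sum_i c i * phi i = 0) ->
      \sum_i f (phi i) * l i = 0) ->
  forall i, l i = 0.
Proof.
move=> H.
have [||U UP] := @vspace_of_pred _ 'rV[rat]_m (fun c => \sum_i f (c 0 i) * l i = 0).
- by rewrite big1 // => i _; rewrite mxE rmorph0 mul0r.
- move=> a u v u0 v0; under eq_bigr do rewrite !mxE rmorphD rmorphM mulrDl -mulrA.
  by rewrite big_split -mulr_sumr /= u0 v0 mulr0 addr0.
pose A := \matrix_(i < \dim U) (vbasis U)`_i.
have AU (w : 'rV_(\dim U)) : w *m A \in U.
  rewrite mulmx_sum_row memv_suml // => i _; rewrite memvZ // rowK.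
  by apply/vbasis_mem/mem_nth; rewrite size_tuple.
have UA c : c \in U -> exists w, c = w *m A.
  move=> /coord_vbasis ->; exists (\row_i coord (vbasis U) i c).
  by rewrite mulmx_sum_row; apply: eq_bigr => i _; rewrite rowK mxE.
have kA (p : 'rV_m) : p *m A^T = 0 -> p = 0.
  move=> pA; have orth c : c \in U -> \sum_i c 0 i * p 0 i = 0.
    move=> /UA[w ->]; have : w *m A *m p^T = 0.
      by rewrite -mulmxA -[A]trmxK -trmx_mul pA trmx0 mulmx0.
    move/matrixP/(_ 0 0); rewrite [LHS]mxE [RHS]mxE => E; rewrite -[RHS]E.
    by apply: eq_bigr => i _; rewrite [p^T _ _]mxE.
  have /UP/orth : \sum_i f (p 0 i) * l i = 0.
    apply: (H (fun i => p 0 i)) => c c0.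
    have cU : \row_i c i \in U by apply/UP; under eq_bigr do rewrite mxE.
    by rewrite -[RHS](orth _ cU); apply: eq_bigr => i _; rewrite mxE.
  move/eqP; rewrite psumr_eq0 => [/allP p0|i _]; last by rewrite -expr2 sqr_ge0.
  apply/rowP=> i; have := p0 i (mem_index_enum i); rewrite -expr2 sqrf_eq0 mxE.
  by move/eqP.
have Afull : row_full A.
  rewrite /row_full -(mxrank_tr A) -/(row_free A^T) -kermx_eq0; apply/eqP/row_matrixP=> i.
  by rewrite row0; apply: kA; rewrite -row_mul mulmx_ker row0.
move=> i; have [w wA] := submxP (submx_full (delta_mx 0 i : 'rV_m) Afull).
have /UP : delta_mx 0 i \in U by rewrite wA.
rewrite (bigD1 i) //= big1 => [|j ji]; rewrite mxE /= ?(negPf ji) ?rmorph0 ?mul0r // eqxx.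
by rewrite rmorph1 mul1r addr0.
Qed.

(** * Functional calculus for two commuting elements *)

Section CommutingPair.
Variables (K : fieldType) (E : algType K).
Implicit Types (a b : E) (p q : {poly K}).

Lemma horner_alg_dvd a p q b : q %| p -> horner_alg a q * b = 0 ->
  horner_alg a p * b = 0.
Proof. by case/dvdpP=> s -> qb; rewrite rmorphM -mulrA qb mulr0. Qed.

Lemma comm_horner_alg a b p : GRing.comm a b -> GRing.comm a (horner_alg b p).
Proof.
move=> ab; elim/poly_ind: p => [|p c IHp]; first by rewrite rmorph0; exact: commr0.
rewrite rmorphD rmorphM /= horner_algX horner_algC.
by apply: commrD; [exact: commrM | by rewrite /GRing.comm mulr_algr mulr_algl].
Qed.

(** Primary decomposition as an induction principle: if the product of the
    [(X - t) ^+ N] evaluated at a kills b, then b is a sum of vectors each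
    killed by one factor.  The summands are polynomials in a applied to b,
    which lets properties of b that commute with a pass to them. *)
Lemma primary_decomposition_ind a N (s : seq K) (P : E -> Prop) :
    P 0 -> (forall b b', P b -> P b' -> P (b + b')) -> uniq s ->
  forall b, horner_alg a (\prod_(t <- s) ('X - t%:P) ^+ N) * b = 0 ->
    (forall t q, t \in s -> horner_alg a (('X - t%:P) ^+ N) * (horner_alg a q * b) = 0 ->
       P (horner_alg a q * b)) ->
  P b.
Proof.
move=> P0 PD; elim: s => [|t s IHs] /=.
  by move=> _ b; rewrite big_nil rmorph1 mul1r => ->.
case/andP=> ts us b; rewrite big_cons.
have /Bezout_eq1_coprimepP[[u v] /= uv] := coprimep_XsubC_exp_prod N ts.
set A := ('X - t%:P) ^+ N in uv *; set B := \prod_(t <- s) _ in uv *.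
move=> ab0 Pb.
have kill q : A * B %| q -> horner_alg a q * b = 0.
  by move=> /horner_alg_dvd; apply.
have -> : b = horner_alg a (v * B) * b + horner_alg a (u * A) * b.
  by rewrite -mulrDl -rmorphD addrC uv rmorph1 mul1r.
apply: PD.
  apply: (Pb t); first exact: mem_head.
  by rewrite mulrA -rmorphM kill // mulrCA dvdp_mull.
apply: IHs => // [|u' q u's].
  by rewrite mulrA -rmorphM kill // mulrCA (mulrC B) dvdp_mull.
by rewrite [horner_alg a q * _]mulrA -rmorphM; apply: Pb; rewrite in_cons u's orbT.
Qed.

Lemma horner_alg_eigen a p t c N b : ('X - t%:P) ^+ N %| p - c%:P ->
  horner_alg a (('X - t%:P) ^+ N) * b = 0 -> horner_alg a p * b = c *: b.
Proof.
move=> pc /(horner_alg_dvd pc) /eqP.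
by rewrite rmorphB mulrBl /= horner_algC subr_eq0 mulr_algl => /eqP.
Qed.

Lemma horner_alg_XsubC_exp a t N :
  horner_alg a (('X - t%:P) ^+ N) = (a - t%:A) ^+ N.
Proof. by rewrite rmorphXn rmorphB /= horner_algX horner_algC. Qed.

(** In the binomial expansion of [(a1 - a2) ^+ (N + N)] each term contains the
    N-th power of a1 or of a2. *)
Lemma exp_subr_comm_eq0 (a1 a2 b : E) N : GRing.comm a1 a2 ->
  a1 ^+ N * b = 0 -> a2 ^+ N * b = 0 -> (a1 - a2) ^+ (N + N) * b = 0.
Proof.
move=> a12 b1 b2; rewrite exprBn_comm // mulr_suml big1 // => i _.
have expl0 (z : E) j : (N <= j)%N -> z ^+ N * b = 0 -> z ^+ j * b = 0.
  by move=> Nj z0; rewrite -(subnK Nj) exprD -mulrA z0 mulr0.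
rewrite mulrnAl -!mulrA; have [Ni|iN] := leqP N i.
  by rewrite (expl0 a2) // !mulr0 mul0rn.
have /(commrX i)/commr_sym/(commrX (N + N - i))/commr_sym a12' := a12.
rewrite [a1 ^+ _ * _]mulrA [a1 ^+ _ * _]a12' -mulrA (expl0 a1) ?mulr0 ?mul0rn //.
by rewrite -addnBA ?leq_addr // ltnW.
Qed.

(** When the values c depend additively on the eigenvalues, in that c t - c u
    is a function of t - u, the difference p(a1) - p(a2) is a polynomial in
    a1 - a2.  Both sides act on a joint generalised eigenspace, for t and u, as
    the scalar c t - c u; interpolating to high order makes this exact there,
    and such spaces span.  The case of interest is the pair of left and right
    multiplications by a matrix x, whose difference is ad x. *)
Lemma additive_functional_calculus (a1 a2 : E) N (s : seq K) (c : K -> K) p P :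
    GRing.comm a1 a2 ->
    horner_alg a1 (\prod_(t <- s) ('X - t%:P) ^+ N) = 0 ->
    horner_alg a2 (\prod_(t <- s) ('X - t%:P) ^+ N) = 0 -> uniq s ->
    (forall t, t \in s -> ('X - t%:P) ^+ N %| p - (c t)%:P) ->
    (forall t u, t \in s -> u \in s ->
       ('X - (t - u)%:P) ^+ (N + N) %| P - (c t - c u)%:P) ->
  horner_alg a1 p - horner_alg a2 p = horner_alg (a1 - a2) P.
Proof.
move=> a12 s1 s2 us ps Ps; apply/eqP; rewrite -subr_eq0 -[X in X == _]mulr1; apply/eqP.
set D := _ - _.
have DD b b' : D * b = 0 -> D * b' = 0 -> D * (b + b') = 0.
  by move=> b0 b'0; rewrite mulrDr b0 b'0 addr0.
suff Dall t u b : t \in s -> u \in s ->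
    horner_alg a1 (('X - t%:P) ^+ N) * b = 0 ->
    horner_alg a2 (('X - u%:P) ^+ N) * b = 0 -> D * b = 0.
  apply: (@primary_decomposition_ind a1 N s (fun b => D * b = 0)) => //.
  - exact: mulr0.
  - by rewrite s1 mul0r.
  move=> t q ts tb0.
  apply: (@primary_decomposition_ind a2 N s (fun b => D * b = 0)) => //.
  - exact: mulr0.
  - by rewrite s2 mul0r.
  move=> u q' us' ub0; apply: (Dall t u) => //.
  have comm12 p1 p2 : GRing.comm (horner_alg a1 p1) (horner_alg a2 p2).
    by apply: comm_horner_alg; apply/commr_sym/comm_horner_alg/commr_sym.
  by rewrite mulrA comm12 -mulrA tb0 mulr0.
move=> ts us' b1 b2; rewrite mulrBl mulrBl (horner_alg_eigen (ps _ ts) b1).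
rewrite (horner_alg_eigen (ps _ us') b2).
rewrite (@horner_alg_eigen _ _ _ _ _ b (Ps _ _ ts us')) ?scalerBl ?subrr //.
rewrite horner_alg_XsubC_exp scalerBl opprB.
have -> : a1 - a2 + (u%:A - t%:A) = (a1 - t%:A) - (a2 - u%:A).
  by rewrite opprB [LHS]addrACA [RHS]addrACA [- a2 - _]addrC.
rewrite exp_subr_comm_eq0 -?horner_alg_XsubC_exp //.
have algC_comm (k : K) (z : E) : GRing.comm z k%:A.
  by rewrite /GRing.comm mulr_algr mulr_algl.
apply: commrB; last exact: algC_comm.
by apply/commr_sym/commrB; [exact/commr_sym | exact: algC_comm].
Qed.
End CommutingPair.

(** * Cartan's nilpotency criterion *)

Definition commutator (R : pzRingType) (a b : R) := a * b - b * a.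

Lemma mxtrace_horner_roots (K : fieldType) n (x : 'M[K]_n.+1) (r : seq K) p :
  char_poly x = \prod_(l <- r) ('X - l%:P) ->
  \tr (horner_mx x p) = \sum_(l <- r) p.[l].
Proof.
move=> rx; rewrite -{1}[p]coefK poly_def raddf_sum (raddf_sum (@mxtrace K n.+1)) /=.
under [RHS]eq_bigr do rewrite horner_coef.
rewrite [RHS]exchange_big. apply: eq_bigr => i _.
by rewrite !linearZ /= rmorphXn /= horner_mx_X (mxtrace_exp_roots rx) mulr_sumr.
Qed.

(** Left and right multiplications by x are seen as commuting elements of the
    endomorphism algebra of the space of matrices, and ad x is their
    difference. *)
Section SplitMatrix.
Variables (K : fieldType) (n : nat) (x : 'M[K]_n.+1).
Let E := 'End('M[K]_n.+1).

Lemma horner_amull p b : horner_alg (amull x : E) p b = horner_mx x p * b.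
Proof.
elim/poly_ind: p b => [|p c IHp] b; first by rewrite !rmorph0 mul0r lfunE.
rewrite !rmorphD !rmorphM /= horner_algX horner_algC horner_mx_X horner_mx_C.
rewrite add_lfunE lfun_mulE scale_lfunE id_lfunE lfunE /= IHp.
have -> : x * (horner_mx x p * b) = horner_mx x p * x * b.
  by rewrite mulrA -{1 4}(horner_mx_X x) -!rmorphM mulrC.
by rewrite mulrDl -!mulmxE mul_scalar_mx.
Qed.

Lemma horner_amulr p b : horner_alg (amulr x : E) p b = b * horner_mx x p.
Proof.
elim/poly_ind: p b => [|p c IHp] b; first by rewrite !rmorph0 mulr0 lfunE.
rewrite !rmorphD !rmorphM /= horner_algX horner_algC horner_mx_X horner_mx_C.
rewrite add_lfunE lfun_mulE scale_lfunE id_lfunE lfunE /= IHp.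
by rewrite mulrDr mulrA -!mulmxE mul_mx_scalar.
Qed.

Lemma exp_ad k b : ((amull x - amulr x : E) ^+ k) b = iter k (commutator x) b.
Proof.
elim: k => [|k IHk] /=; first by rewrite id_lfunE.
by rewrite exprSr lfun_mulE IHk add_lfunE opp_lfunE !lfunE.
Qed.

Lemma horner_ad P b : horner_alg (amull x - amulr x : E) P b =
  \sum_(i < size P) P`_i *: iter i (commutator x) b.
Proof.
rewrite -{1}[P]coefK poly_def raddf_sum sum_lfunE; apply: eq_bigr => i _.
by rewrite /= -mul_polyC rmorphM rmorphXn /= horner_algX horner_algC mulr_algl -exp_ad scale_lfunE.
Qed.

Lemma comm_amull_amulr : GRing.comm (amull x : E) (amulr x).
Proof. by apply/lfunP=> b; rewrite !lfun_mulE !lfunE /= mulrA. Qed.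

End SplitMatrix.

Lemma horner_of_dvdp (K : fieldType) N t c (p : {poly K}) :
  ('X - t%:P) ^+ N.+1 %| p - c%:P -> p.[t] = c.
Proof.
case/dvdpP=> q /(congr1 (fun p => p.[t])); rewrite !hornerE subrr expr0n mulr0.
by move/eqP; rewrite subr_eq0 => /eqP.
Qed.

(** Cartan's criterion when the eigenvalues l_i of x are in the field.  For
    phi orthogonal to the rational relations between the l_i, the matrix p(x)
    with eigenvalues phi_i satisfies [p(x), b] = P(ad x) b with P(0) = 0, so
    the hypothesis gives tr(x p(x)) = 0, that is, sum_i l_i phi_i = 0. *)
Lemma nilpotent_of_trace_split (K : fieldType) n (x : 'M[K]_n.+1) (r : seq K)
    (s : seq ('M[K]_n.+1 * 'M[K]_n.+1)) : [pchar K] =i pred0 ->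
    char_poly x = \prod_(l <- r) ('X - l%:P) ->
    x = \sum_(ab <- s) commutator ab.1 ab.2 ->
    (forall k, \sum_(ab <- s) \tr (ab.1 * iter k.+1 (commutator x) ab.2) = 0) ->
  x ^+ n.+1 = 0.
Proof.
move=> charK rx xs trs.
have szr : size r = n.+1.
  by have := size_char_poly x; rewrite rx size_prod_XsubC => -[].
pose l (i : 'I_n.+1) := r`_i.
have mem_l i : l i \in r by rewrite mem_nth ?szr.
have r_l t : t \in r -> exists i, t = l i.
  move=> tr; have ir : (index t r < n.+1)%N by rewrite -szr index_mem.
  by exists (Ordinal ir); rewrite /l nth_index.
suff l0 i : l i = 0.
  have := Cayley_Hamilton x; rewrite rx (eq_big_seq (fun=> 'X)) => [|t /r_l[i ->]]; last first.
    by rewrite l0 subr0.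
  by rewrite big_const_seq count_predT szr iter_mulr_1 rmorphXn /= horner_mx_X.
have [f] := rat_embedding charK.
apply: (@eq0_of_rational_functionals _ f) => {i} phi orth.
(* phi is orthogonal to the relation e_i - e_j - (e_k - e_h) *)
have phiB i j k h : l i - l j = l k - l h -> phi i - phi j = phi k - phi h.
  have sum_delta (R : pzRingType) (g : 'I_n.+1 -> R) m : \sum_t (t == m)%:R * g t = g m.
    by rewrite (bigD1 m) //= big1 ?eqxx ?mul1r ?addr0 // => t /negPf->; rewrite mul0r.
  move=> /eqP; rewrite -subr_eq0 => /eqP lE; apply/eqP; rewrite -subr_eq0; apply/eqP.
  have sumE (R : pzRingType) (g : 'I_n.+1 -> R) :
      \sum_t ((t == i)%:R - (t == j)%:R - ((t == k)%:R - (t == h)%:R)) * g t =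
      g i - g j - (g k - g h).
    by under eq_bigr do rewrite !mulrBl; rewrite !sumrB !sum_delta.
  rewrite -(sumE _ phi); apply: orth; rewrite -[RHS]lE -sumE.
  by apply: eq_bigr => t _; rewrite !rmorphB !rmorph_nat.
(* d and c are the functions l_i - l_j |-> phi_i - phi_j and l_i |-> phi_i *)
pose d t := if [pick ij : 'I_n.+1 * 'I_n.+1 | l ij.1 - l ij.2 == t] is Some ij
  then f (phi ij.1 - phi ij.2) else 0.
have dE i j : d (l i - l j) = f (phi i) - f (phi j).
  rewrite /d; case: pickP => [[k h] /= /eqP/phiB->|/(_ (i, j))/eqP//].
  by rewrite rmorphB.
pose c t := if [pick i | l i == t] is Some i then f (phi i) else 0.
have cE i : c (l i) = f (phi i).
  rewrite /c; case: pickP => [k /= /eqP lki|/(_ i)/eqP//].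
  have /eqP := phiB k i i i (congr1 (+%R^~ (- l i)) lki).
  by rewrite subrr subr_eq0 => /eqP->.
pose N := n.+1.
have [p pP] := hermite_interpolation N (undup r) c.
have [P PP] := hermite_interpolation (N + N) [seq t - u | t <- r, u <- r] d.
have rP : char_poly x %| \prod_(t <- undup r) ('X - t%:P) ^+ N.
  rewrite rx -prodr_undup_exp_count; apply: (big_ind2 (fun u v : {poly K} => u %| v)) => //.
    by move=> *; exact: dvdp_mul.
  by move=> t _; rewrite dvdp_exp2l // -[N]szr count_size.
have hx0 : horner_mx x (\prod_(t <- undup r) ('X - t%:P) ^+ N) = 0.
  by case/dvdpP: rP => q ->; rewrite rmorphM /= Cayley_Hamilton mulr0.
have adE b : commutator (horner_mx x p) b =
    horner_alg (amull x - amulr x : 'End('M[K]_n.+1)) P b.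
  rewrite -(@additive_functional_calculus _ _ (amull x) (amulr x) N (undup r) c p P).
  - by rewrite add_lfunE opp_lfunE horner_amull horner_amulr.
  - exact: comm_amull_amulr.
  - by apply/lfunP=> b'; rewrite horner_amull hx0 mul0r lfunE.
  - by apply/lfunP=> b'; rewrite horner_amulr hx0 mulr0 lfunE.
  - exact: undup_uniq.
  - exact: pP.
  move=> t u; rewrite !mem_undup => tr ur.
  have [[i tE] [j uE]] := (r_l _ tr, r_l _ ur).
  by rewrite tE uE !cE -dE; apply: PP; apply: allpairs_f; rewrite -?tE -?uE.
(* 0 is the difference of an eigenvalue with itself, where P takes the value 0 *)
have P0 : P`_0 = 0.
  have := PP (l ord0 - l ord0) (allpairs_f _ (mem_l _) (mem_l _)).
  by rewrite dE !subrr => /horner_of_dvdp; rewrite horner_coef0.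
have : \sum_(ab <- s) \tr (ab.1 * commutator (horner_mx x p) ab.2) = 0.
  under eq_bigr do rewrite adE horner_ad mulr_sumr (raddf_sum (@mxtrace K n.+1)).
  rewrite exchange_big big1 //= => -[[|k] kP] _ /=.
    by rewrite big1 // => ab _; rewrite P0 scale0r mulr0 mxtrace0.
  by under eq_bigr do rewrite -scalerAr mxtraceZ; rewrite -mulr_sumr trs mulr0.
under eq_bigr => ab _.
  have -> : \tr (ab.1 * commutator (horner_mx x p) ab.2) = - \tr (commutator ab.1 ab.2 * horner_mx x p).
    rewrite /commutator mulrBr mulrBl !linearB /= opprB !mulrA; congr (_ - _).
    by rewrite [LHS]mxtrace_mulC mulmxE mulrA.
over.
rewrite sumrN -(raddf_sum (@mxtrace K n.+1)) -mulr_suml -xs => /eqP; rewrite oppr_eq0 => /eqP.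
have -> : x * horner_mx x p = horner_mx x ('X * p) by rewrite rmorphM /= horner_mx_X.
move=> /(etrans (esym (mxtrace_horner_roots ('X * p) rx))).
rewrite (big_nth 0) szr big_mkord => tr0.
rewrite -[RHS]tr0; apply: eq_bigr => i _; rewrite hornerM hornerX mulrC -cE.
congr (_ * _); apply/esym/horner_of_dvdp; apply: pP.
by rewrite mem_undup mem_l.
Qed.

Lemma map_mx_commutator (R S : pzRingType) (f : {rmorphism R -> S}) n (a b : 'M[R]_n) :
  map_mx f (commutator a b) = commutator (map_mx f a) (map_mx f b).
Proof. by rewrite /commutator map_mxB -!mulmxE !map_mxM. Qed.

(** Nilpotency and traces can be tested over a splitting field of the
    characteristic polynomial of x. *)
Lemma nilpotent_of_trace (F : fieldType) n (x : 'M[F]_n.+1)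
    (s : seq ('M[F]_n.+1 * 'M[F]_n.+1)) : [pchar F] =i pred0 ->
    x = \sum_(ab <- s) commutator ab.1 ab.2 ->
    (forall k, \sum_(ab <- s) \tr (ab.1 * iter k.+1 (commutator x) ab.2) = 0) ->
  x ^+ n.+1 = 0.
Proof.
move=> charF xs trs.
have [K [f [r fr]]] := splitting_extension (char_poly_monic x).
have charK : [pchar K] =i pred0 by move=> p; rewrite (fmorph_pchar f) charF.
apply: (@map_mx_inj _ _ f); rewrite map_mx0 rmorphXn /=.
apply: (@nilpotent_of_trace_split _ _ _ r [seq (map_mx f ab.1, map_mx f ab.2) | ab <- s]) => //.
- by rewrite -map_char_poly.
- by rewrite big_map {1}xs raddf_sum; apply: eq_bigr => ab _; rewrite -map_mx_commutator.
move=> k; rewrite big_map -[RHS](rmorph0 f) -(trs k) rmorph_sum.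
apply: eq_bigr => ab _; rewrite -mulmxE -trace_map_mx map_mxM; congr (\tr (_ *m _)).
by elim: k.+1 => //= j ->; rewrite -map_mx_commutator.
Qed.

(** * Engel's theorem *)

Section CommutatorTheory.
Variables (R : pzRingType).
Implicit Types a b c : R.

Lemma commutatorDl a b c : commutator (a + b) c = commutator a c + commutator b c.
Proof. by rewrite /commutator mulrDl mulrDr opprD addrACA. Qed.

Lemma commutatorDr a b c : commutator c (a + b) = commutator c a + commutator c b.
Proof. by rewrite /commutator mulrDl mulrDr opprD addrACA. Qed.

Lemma commutatorC a b : commutator a b = - commutator b a.
Proof. by rewrite /commutator opprB. Qed.

Lemma commutatorxx a : commutator a a = 0.
Proof. by rewrite /commutator subrr. Qed.

End CommutatorTheory.

Lemma commutatorZl (F : fieldType) n k (a b : 'M[F]_n.+1) :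
  commutator (k *: a) b = k *: commutator a b.
Proof. by rewrite /commutator scalerBr -scalerAl -scalerAr. Qed.

Lemma commutatorZr (F : fieldType) n k (a b : 'M[F]_n.+1) :
  commutator a (k *: b) = k *: commutator a b.
Proof. by rewrite /commutator scalerBr -scalerAl -scalerAr. Qed.

Section Engel.
Variables (F : fieldType) (n : nat).
Local Notation A := 'M[F]_n.+1.
Local Notation V := 'rV[F]_n.+1.
Implicit Types (H : {vspace A}) (U W : {vspace V}) (x h : A) (w : seq A).

Definition stable_under H U := forall h u, h \in H -> u \in U -> u *m h \in U.

(** A form of Engel's property that is stronger than having a common null
    vector: it asks for a null vector in the quotient by each proper stable
    subspace.  It therefore yields a flag, and passes from H to H + <x>. *)
Definition nil_on_quotients H := forall U, U != fullv -> stable_under H U ->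
  exists2 v, v \notin U & forall h, h \in H -> v *m h \in U.

Lemma vspace_transporter H U :
  exists W, forall v, v \in W <-> forall h, h \in H -> v *m h \in U.
Proof.
apply: vspace_of_pred => [h _|a u v uU vU h hH]; first by rewrite mul0mx mem0v.
by rewrite mulmxDl -scalemxAl memvD ?memvZ ?uU ?vU.
Qed.

(** The successive transporters form a strictly increasing flag, which each
    further letter of a word descends by one step. *)
Lemma words_vanish H : nil_on_quotients H ->
  exists N, forall w, {subset w <= H} -> (N <= size w)%N -> \prod_(h <- w) h = 0.
Proof.
move=> nilH.
suff vanish U : stable_under H U -> exists N, forall w v, {subset w <= H} -> size w = N ->
    v *m (\prod_(h <- w) h) \in U.
  have [|N wN] := vanish 0%VS.
    by move=> h u _; rewrite !memv0 => /eqP->; rewrite mul0mx.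
  exists N => w wH Nw; rewrite -(cat_take_drop N w) big_cat /=.
  suff -> : \prod_(h <- take N w) h = 0 by rewrite mul0r.
  apply/row_matrixP=> i; rewrite row0 rowE.
  apply/eqP; rewrite -memv0; apply: wN; last exact: size_takel.
  by move=> h /mem_take/wH.
elim/dimv_strict_ind: U => U IHU stU.
have [->|Uf] := eqVneq U fullv; first by exists 0 => w v _ _; exact: memvf.
have [W WP] := vspace_transporter H U; have [v vU vW] := nilH U Uf stU.
have UW : {subset U <= W} by move=> u uU; apply/WP=> h hH; exact: stU.
have [||N wN] := IHU W; first by apply: dimv_ltS vU; rewrite ?WP.
  by move=> h u hH /WP uW; apply: UW; exact: uW.
exists N.+1; elim/last_ind=> // w h _ u wH; rewrite size_rcons => -[szw].
rewrite -cats1 big_cat big_seq1 /= -mulmxE mulmxA.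
have /WP : u *m \prod_(h <- w) h \in W.
  by apply: wN => // h' h'w; apply: wH; rewrite mem_rcons in_cons h'w orbT.
by apply; apply: wH; rewrite mem_rcons mem_head.
Qed.

Variable I : A -> Prop.
Hypothesis I_lin : forall a x y, I x -> I y -> I (a *: x + y).
Hypothesis I_comm : forall x y, I x -> I y -> I (commutator x y).
Hypothesis I_nil : forall x, I x -> x ^+ n.+1 = 0.

(** Bracketing x with elements of H cannot go on forever outside H: an
    iterated bracket is a combination of products w1 x w2 with words w1 and w2
    in H, and a long word in H is zero.  The last bracket that is not in H
    normalises H. *)
Lemma exists_normalizer H x : (forall h, h \in H -> I h) -> nil_on_quotients H ->
    I x -> x \notin H ->
  exists y, [/\ I y, y \notin H & forall h, h \in H -> commutator y h \in H].
Proof.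
move=> HI /words_vanish[N wN].
suff norm (k : nat) : forall x, I x -> x \notin H ->
    (forall w1 w2, {subset w1 <= H} -> {subset w2 <= H} -> (size w1 + size w2)%N = k ->
       (\prod_(h <- w1) h) * x * (\prod_(h <- w2) h) = 0) ->
    exists y, [/\ I y, y \notin H & forall h, h \in H -> commutator y h \in H].
  move=> Ix xH; apply: (norm (N + N)%N x) => // w1 w2 w1H w2H szw.
  have [/(wN _ w1H)->|w1N] := leqP N (size w1); first by rewrite !mul0r.
  have Nw2 : (N <= size w2)%N by rewrite -(leq_add2l (size w1)) szw leq_add2r ltnW.
  by rewrite (wN w2 w2H Nw2) mulr0.
(* induction on the total length k of words that suffices to kill x *)
elim: k => [|k IHk] {}x Ix xH x0.
  by have := x0 [::] [::]; rewrite !big_nil mul1r mulr1 => x00; rewrite x00 ?mem0v in xH.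
have [xN|/existsNP[h /not_implyP[hH /negP xh]]] := pselect (forall h, h \in H -> commutator x h \in H).
  by exists x.
apply: (IHk (commutator x h)) => // [|w1 w2 w1H w2H szw]; first exact: I_comm (HI _ hH).
have := x0 w1 (h :: w2) w1H; have := x0 (rcons w1 h) w2.
rewrite -cats1 big_cat big_seq1 big_cons /= size_cat addn1 addnS szw addSn szw => e1 e2.
rewrite /commutator mulrBr mulrBl !mulrA e1 // ?subr0; last first.
  by move=> y; rewrite mem_cat mem_seq1 => /orP[/w1H|/eqP->].
by rewrite -[_ * h * _]mulrA e2 // => y; rewrite in_cons => /predU1P[->|/w2H].
Qed.

(** The vectors that H sends into U form a space W stable under x, because x
    normalises H; x being nilpotent, it has a null vector in W modulo U. *)
Lemma nil_on_quotients_add H x : I x -> (forall h, h \in H -> commutator x h \in H) ->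
  nil_on_quotients H -> nil_on_quotients (H + <[x]>)%VS.
Proof.
move=> Ix xH nilH U Uf stU.
have sHx : {subset H <= (H + <[x]>)%VS} by apply/subvP/addvSl.
have xHx : x \in (H + <[x]>)%VS by rewrite (subvP (addvSr _ _)) ?memv_line.
have [W WP] := vspace_transporter H U.
have [|v vU vW] := nilH U Uf; first by move=> h u /sHx; exact: stU.
have Wx u : u \in W -> u *m x \in W.
  move=> /WP uW; apply/WP => h hH.
  have -> : u *m x *m h = u *m h *m x + u *m commutator x h.
    by rewrite /commutator mulmxBr -!mulmxE !mulmxA addrC subrK.
  by rewrite memvD ?uW ?xH // stU // uW.
have vxW k : v *m x ^+ k \in W.
  elim: k => [|k IHk]; first by rewrite expr0 mulmx1; apply/WP.
  by rewrite exprSr -mulmxE mulmxA Wx.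
have ex : exists k, v *m x ^+ k \in U by exists n.+1; rewrite I_nil // mulmx0 mem0v.
case: (ex_minnP ex) => -[|k]; first by rewrite expr0 mulmx1 (negPf vU).
move=> vxU kmin; exists (v *m x ^+ k).
  by apply/negP=> /kmin; rewrite ltnn.
move=> _ /memv_addP[h hH [_ /vlineP[a ->] ->]].
rewrite mulmxDr memvD //; first exact: (WP _).1.
by rewrite -scalemxAr memvZ // -mulmxA mulmxE -exprSr.
Qed.

(** Starting from H = 0, add elements of I that normalise H until H exhausts
    I. *)
Theorem engel : I 0 -> exists2 v : V, v != 0 & forall x, I x -> v *m x = 0.
Proof.
move=> I0.
suff ext H : (forall h, h \in H -> I h) -> (forall x y, x \in H -> y \in H -> commutator x y \in H) ->
    nil_on_quotients H ->
    exists2 H', nil_on_quotients H' & forall x, I x -> x \in H'.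
  have [|||H nilH HI] := ext 0%VS.
  - by move=> h; rewrite memv0 => /eqP->.
  - by move=> x y; rewrite !memv0 /commutator => /eqP-> /eqP->; rewrite mulr0 subr0.
  - move=> U Uf _; have /existsNP[v /negP vU] : ~ forall v, v \in U.
      by move=> Uall; case/eqP: Uf; apply/vspaceP=> v; rewrite memvf Uall.
    by exists v => // h; rewrite memv0 => /eqP->; rewrite mulmx0 mem0v.
  have [||v v0 vH] := nilH 0%VS.
  - apply/eqP=> /vspaceP/(_ (const_mx 1)); rewrite memvf memv0.
    by case: eqP => // /matrixP/(_ 0 0)/eqP; rewrite !mxE oner_eq0.
  - by move=> h u _; rewrite !memv0 => /eqP->; rewrite mul0mx.
  exists v; first by rewrite -memv0.
  by move=> x /HI/vH; rewrite memv0 => /eqP.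
elim/dimv_strict_ind: H => H IHH HI Hcomm nilH.
have [allH|/existsNP[x /not_implyP[Ix /negP xH]]] := pselect (forall x, I x -> x \in H).
  by exists H.
have [y [Iy yH yN]] := exists_normalizer HI nilH Ix xH.
have sHy : {subset H <= (H + <[y]>)%VS} by apply/subvP/addvSl.
apply: (IHH (H + <[y]>)%VS).
- by apply: dimv_ltS yH => //; rewrite (subvP (addvSr _ _)) ?memv_line.
- by move=> _ /memv_addP[h hH [_ /vlineP[a ->] ->]]; rewrite addrC; apply: I_lin => //; apply: HI.
- move=> _ _ /memv_addP[h hH [_ /vlineP[a ->] ->]] /memv_addP[h' h'H [_ /vlineP[b ->] ->]].
  apply: sHy; rewrite commutatorDl !commutatorDr !commutatorZl !commutatorZr
    commutatorxx !scaler0 addr0 (commutatorC h y).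
  by apply: memvD; [apply: memvD|]; rewrite ?memvZ ?memvN ?yN ?Hcomm.
exact: nil_on_quotients_add.
Qed.
End Engel.

(** * The trace form and invariant tensors *)

Lemma linear_comb (F : pzRingType) (U W : lmodType F) (f : U -> W) : linear f ->
  forall I (r : seq I) (c : I -> F) (x : I -> U),
    f (\sum_(i <- r) c i *: x i) = \sum_(i <- r) c i *: f (x i).
Proof.
move=> fl I r c x; elim/big_rec2: _ => [|i w u _ <-]; last exact: fl.
by have := zmod_morphism_linear fl 0 0; rewrite !subrr.
Qed.

Section TraceForm.
Variables (F : fieldType) (charF : [pchar F] =i pred0) (n : nat).
Local Notation A := 'M[F]_n.+1.
Local Notation V := 'rV[F]_n.+1.
Variable G : {vspace A}.
Hypothesis G_comm : forall x y, x \in G -> y \in G -> commutator x y \in G.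
Hypothesis G_irr : forall U : {vspace V}, stable_under G U -> U = 0%VS \/ U = fullv.

Definition trace_nondegenerate :=
  forall a, a \in G -> (forall b, b \in G -> \tr (a * b) = 0) -> a = 0.

(** The tensor sum of p.1 (x) p.2 is killed by the adjoint action of G; this is
    expressed through all bilinear maps out of pairs of matrices.  Only the
    first factors need to be in G, so that z (x) 1 is allowed for z central. *)
Definition invariant_tensor (s : seq (A * A)) : Prop :=
  [/\ forall p, p \in s -> p.1 \in G,
      \sum_(p <- s) p.1 * p.2 != 0 &
      forall (W : lmodType F) (beta : A -> A -> W),
        (forall b, linear (beta^~ b)) -> (forall a, linear (beta a)) ->
      forall v, v \in G ->
        \sum_(p <- s) (beta (commutator v p.1) p.2 + beta p.1 (commutator v p.2)) = 0].

Lemma mxtrace_commutator (a b c : A) : \tr (commutator a b * c) = \tr (a * commutator b c).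
Proof.
rewrite /commutator mulrBl mulrBr !linearB /= !mulrA; congr (_ - _).
by rewrite -(mulrA b) [LHS]mxtrace_mulC mulmxE.
Qed.

(** For a in the radical R of the trace form, the elements of [R,G] are
    nilpotent and so, by Engel's theorem and irreducibility, act as zero. *)
Lemma central_or_nondegenerate :
  (exists z, [/\ z \in G, z != 0 & forall g, g \in G -> commutator z g = 0]) \/
  trace_nondegenerate.
Proof.
have [|/existsNP[a /not_implyP[aG /not_implyP[aR /eqP a0]]]] := pselect trace_nondegenerate.
  by right.
left; exists a; split=> //.
pose R r := r \in G /\ forall b, b \in G -> \tr (r * b) = 0.
have R_comm r g : R r -> g \in G -> R (commutator r g).
  move=> [rG r0] gG; split=> [|b bG]; first exact: G_comm.
  by rewrite mxtrace_commutator r0 // G_comm.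
have R_lin c r r' : R r -> R r' -> R (c *: r + r').
  move=> [rG r0] [r'G r'0]; split=> [|b bG]; first by rewrite memvD ?memvZ.
  by rewrite mulrDl -scalerAl linearD /= linearZ /= r0 // r'0 // mulr0 addr0.
have R0 : R 0 by split=> [|b _]; rewrite ?mem0v // mul0r mxtrace0.
pose I x := exists2 s : seq (A * A),
  (forall p, p \in s -> R p.1 /\ p.2 \in G) & x = \sum_(p <- s) commutator p.1 p.2.
have IR x : I x -> R x.
  case=> s sRG ->; rewrite big_seq; apply: big_ind => // [r r' Rr Rr'|p /sRG[]].
    by rewrite -[r]scale1r; exact: R_lin.
  exact: R_comm.
have RGI r g : R r -> g \in G -> I (commutator r g).
  move=> Rr gG; exists [:: (r, g)]; last by rewrite big_seq1.
  by move=> p; rewrite mem_seq1 => /eqP->.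
have I0 : I 0 by exists [::] => //; rewrite big_nil.
have I_lin c x y : I x -> I y -> I (c *: x + y).
  move=> [s sRG ->] [t tRG ->].
  exists ([seq (c *: p.1, p.2) | p <- s] ++ t).
    move=> p; rewrite mem_cat => /orP[/mapP[q /sRG[Rq Gq] ->]|/tRG//]; split=> //=.
    by rewrite -[c *: _]addr0; exact: R_lin.
  rewrite big_cat big_map scaler_sumr; congr (_ + _).
  by apply: eq_bigr => p _; rewrite commutatorZl.
have I_nil x : I x -> x ^+ n.+1 = 0.
  move=> Ix; have [s sRG xs] := Ix.
  apply: (nilpotent_of_trace charF xs) => k; rewrite big_seq big1 // => p /sRG[[_ p0] pG].
  apply: p0; elim: k => [|k IHk]; rewrite [iter _ _ _]/=; apply: G_comm => //.
    by case: (IR _ Ix).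
  by case: (IR _ Ix).
have [|v v0 vI] := engel I_lin _ I_nil I0.
  by move=> x y /IR Rx /IR[yG _]; exact: RGI.
have [||K KP] := @vspace_of_pred _ V (fun u => forall x, I x -> u *m x = 0).
- by move=> x _; rewrite mul0mx.
- by move=> c u w u0 w0 x Ix; rewrite mulmxDl -scalemxAl u0 // w0 // scaler0 addr0.
have [|K0|Kf g gG] := G_irr (U := K).
- move=> g u gG /KP uK; apply/KP => x Ix.
  have -> : u *m g *m x = u *m x *m g - u *m commutator x g.
    by rewrite /commutator mulmxBr -!mulmxE !mulmxA subKr.
  by rewrite !uK ?mul0mx ?subr0 //; apply: RGI => //; exact: IR.
- by case/negP: v0; rewrite -memv0 -K0; apply/(KP v).2.
apply/row_matrixP=> i; rewrite row0 rowE.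
by have := memvf (delta_mx 0 i : V); rewrite -Kf => /KP; apply; exact: RGI.
Qed.

Section Casimir.
Hypothesis G_nondeg : trace_nondegenerate.
Let m := \dim G.
Let e (i : 'I_m) : A := (vbasis G)`_i.
Let gram : 'M[F]_m := \matrix_(i, j) \tr (e i * e j).

Let e_G i : e i \in G.
Proof. by apply/vbasis_mem/mem_nth; rewrite size_tuple. Qed.

(** A relation between the rows of the Gram matrix is a vector orthogonal to
    all of G. *)
Lemma gram_unit : gram \in unitmx.
Proof.
suff ker0 (c : 'rV_m) : c *m gram = 0 -> c = 0.
  rewrite -row_free_unit -kermx_eq0; apply/eqP/row_matrixP=> i.
  by rewrite row0; apply: ker0; rewrite -row_mul mulmx_ker row0.
move=> c0.
have s0 : \sum_j c 0 j *: e j = 0.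
  apply: G_nondeg => [|b /coord_vbasis->].
    by apply: memv_suml => j _; rewrite memvZ.
  rewrite mulr_sumr (raddf_sum (@mxtrace F n.+1)) big1 // => k _ /=.
  rewrite -scalerAr mxtraceZ mulr_suml (raddf_sum (@mxtrace F n.+1)) /=.
  transitivity (coord (vbasis G) k b * (c *m gram) 0 k); last by rewrite c0 mxE mulr0.
  congr (_ * _); rewrite mxE; apply: eq_bigr => j _.
  by rewrite [gram _ _]mxE -mxtraceZ -scalerAl.
by apply/rowP=> j; rewrite [RHS]mxE; have /freeP := basis_free (vbasisP G); apply.
Qed.

Let e' (j : 'I_m) : A := \sum_k invmx gram k j *: e k.

Let e'_G j : e' j \in G.
Proof. by apply: memv_suml => k _; rewrite memvZ. Qed.

Lemma mxtrace_dual i j : \tr (e i * e' j) = (i == j)%:R.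
Proof.
have := congr1 (fun M : 'M_m => M i j) (mulmxV gram_unit); rewrite mxE [RHS]mxE => <-.
rewrite mulr_sumr (raddf_sum (@mxtrace F n.+1)); apply: eq_bigr => k _ /=.
by rewrite -scalerAr mxtraceZ mxE mulrC.
Qed.

Lemma coord_dual g : g \in G -> g = \sum_j \tr (g * e' j) *: e j.
Proof.
move=> gG; rewrite {1}(coord_vbasis gG); apply: eq_bigr => j _; congr (_ *: _).
rewrite {2}(coord_vbasis gG) mulr_suml (raddf_sum (@mxtrace F n.+1)) (bigD1 j) //= big1 => [|k kj].
  by rewrite -scalerAl mxtraceZ mxtrace_dual eqxx mulr1 addr0.
by rewrite -scalerAl mxtraceZ mxtrace_dual (negPf kj) mulr0.
Qed.

Lemma coord_basis g : g \in G -> g = \sum_j \tr (g * e j) *: e' j.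
Proof.
move=> gG; apply/eqP; rewrite -subr_eq0; apply/eqP/G_nondeg.
  by rewrite memvB ?memv_suml // => j _; rewrite memvZ.
move=> b bG; rewrite mulrBl linearB /= {1}(coord_dual bG) mulr_sumr mulr_suml.
rewrite !(raddf_sum (@mxtrace F n.+1)) -sumrB big1 // => j _ /=.
rewrite -scalerAr -scalerAl !mxtraceZ -[\tr (e' j * b)]mxtrace_mulC mulmxE.
by rewrite mulrC subrr.
Qed.

(** Expanding [v, e_i] in the basis e and [v, e'_i] in the dual basis e', the
    coefficients are opposite, by invariance of the trace form. *)
Lemma casimir_invariant (W : lmodType F) (beta : A -> A -> W) :
    (forall b, linear (beta^~ b)) -> (forall a, linear (beta a)) ->
  forall v, v \in G ->
    \sum_i (beta (commutator v (e i)) (e' i) + beta (e i) (commutator v (e' i))) = 0.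
Proof.
move=> bl br v vG.
under eq_bigr => i _.
  rewrite {1}(coord_dual (G_comm vG (e_G i))) (linear_comb (bl _)).
  rewrite {1}(coord_basis (G_comm vG (e'_G i))) (linear_comb (br _)).
over.
rewrite big_split /= [X in _ + X]exchange_big -big_split big1 //= => i _.
rewrite -big_split big1 //= => j _; rewrite -scalerDl.
suff -> : \tr (commutator v (e i) * e' j) = - \tr (commutator v (e' j) * e i) by rewrite addNr scale0r.
by rewrite !mxtrace_commutator (commutatorC (e' j)) mulrN [in RHS]linearN opprK.
Qed.


Lemma casimir_tensor : G != 0%VS -> exists s, invariant_tensor s.
Proof.
move=> G0; exists [seq (e i, e' i) | i <- enum 'I_m]; split.
- by move=> p /mapP[i _ ->]; exact: e_G.
- apply: contraNneq G0 => C0; have := congr1 (@mxtrace F n.+1) C0.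
  rewrite big_map big_enum (raddf_sum (@mxtrace F n.+1)) mxtrace0 /=.
  under eq_bigr do rewrite mxtrace_dual // eqxx.
  by rewrite sumr_const card_ord => /eqP; rewrite (pcharf0P _).1 // dimv_eq0.
move=> W beta bl br v vG; rewrite big_map big_enum.
exact: casimir_invariant.
Qed.

End Casimir.

(** Schur's lemma: invariance makes C commute with G, so its kernel is
    invariant, and it is proper since C is nonzero. *)
Lemma invariant_tensor_unit s : invariant_tensor s -> \sum_(p <- s) p.1 * p.2 \in unitmx.
Proof.
case=> _ C0 inv; set C := \sum_(p <- s) _ in C0 *.
have CG v : v \in G -> commutator v C = 0.
  move=> vG; rewrite -(inv _ (fun a b : A => a * b) _ _ v vG).
  - rewrite /commutator mulr_sumr mulr_suml -sumrB; apply: eq_bigr => p _.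
    by rewrite mulrBl mulrBr !mulrA addrA subrK.
  - by move=> b k x y; rewrite mulrDl scalerAl.
  - by move=> a k x y; rewrite mulrDr scalerAr.
have [|k u w uC wC|K KP] := @vspace_of_pred _ V (fun u => u *m C = 0).
- by rewrite mul0mx.
- by rewrite mulmxDl -scalemxAl uC wC scaler0 addr0.
have [g u gG /KP uC|K0|Kf] := G_irr (U := K).
- apply/KP; have /eqP := CG _ gG; rewrite /commutator subr_eq0 -!mulmxE => /eqP gC.
  by rewrite -mulmxA gC mulmxA uC mul0mx.
- rewrite -row_free_unit -kermx_eq0; apply/eqP/row_matrixP=> i; rewrite row0.
  by apply/eqP; rewrite -memv0 -K0; apply/KP; rewrite -row_mul mulmx_ker row0.
case/eqP: C0; apply/row_matrixP=> i; rewrite row0 rowE.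
by have := memvf (delta_mx 0 i : V); rewrite -Kf => /KP.
Qed.

Theorem exists_invariant_tensor : G != 0%VS -> exists s, invariant_tensor s.
Proof.
move=> G0; case: central_or_nondegenerate => [[z [zG z0 zC]]|nd]; last exact: casimir_tensor.
have lin0 (W : lmodType F) (f : A -> W) : linear f -> f 0 = 0.
  by move=> fl; have := zmod_morphism_linear fl 0 0; rewrite !subrr.
exists [:: (z, 1)]; split.
- by move=> p; rewrite mem_seq1 => /eqP->.
- by rewrite big_seq1 mulr1.
move=> W beta bl br v vG; rewrite big_seq1 /= commutatorC zC // oppr0.
by rewrite /commutator mulr1 mul1r subrr (lin0 _ _ (bl 1)) (lin0 _ _ (br z)) addr0.
Qed.

End TraceForm.

(** * Contraction of cochains *)

Lemma filter_enum_lift n (i : 'I_n.+1) :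
  [seq l <- enum 'I_n.+1 | l != i] = map (lift i) (enum 'I_n).
Proof.
apply: (inj_map val_inj); apply: (irr_sorted_eq ltn_trans ltnn).
- by rewrite (subseq_sorted ltn_trans (map_subseq _ (filter_subseq _ _))) // val_enum_ord iota_ltn_sorted.
- rewrite -map_comp sorted_map (@sub_sorted _ (relpre val ltn)) //.
    by move=> a b /= ab; rewrite ltnNge leq_bump2 -ltnNge.
  by rewrite -sorted_map val_enum_ord iota_ltn_sorted.
apply/eq_mem_map=> l; rewrite mem_filter mem_enum andbT.
apply/idP/mapP => [li|[k _ ->]]; last by rewrite eq_sym neq_lift.
by case: (unliftP i l) li => [k ->|->]; [exists k; rewrite ?mem_enum|rewrite eqxx].
Qed.

Section FinfunCons.
Variable (T : Type).

Definition fcons n (x : T) (v : {ffun 'I_n -> T}) : {ffun 'I_n.+1 -> T} :=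
  [ffun k => oapp v x (unlift ord0 k)].

Definition omit_arg n (i : 'I_n.+1) (v : {ffun 'I_n.+1 -> T}) : {ffun 'I_n -> T} :=
  [ffun k => v (lift i k)].

Lemma fcons0 n x (v : {ffun 'I_n -> T}) : fcons x v ord0 = x.
Proof. by rewrite ffunE unlift_none. Qed.

Lemma fconsS n x (v : {ffun 'I_n -> T}) k : fcons x v (lift ord0 k) = v k.
Proof. by rewrite ffunE liftK. Qed.

Lemma eq_fcons n x (v : {ffun 'I_n -> T}) (w : {ffun 'I_n.+1 -> T}) :
  w ord0 = x -> (forall k, w (lift ord0 k) = v k) -> w = fcons x v.
Proof.
move=> w0 wS; apply/ffunP=> k; case: (unliftP ord0 k) => [j ->|->].
  by rewrite fconsS.
by rewrite fcons0.
Qed.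

Lemma omit_arg_fcons0 n x (v : {ffun 'I_n -> T}) : omit_arg ord0 (fcons x v) = v.
Proof. by apply/ffunP=> k; rewrite ffunE fconsS. Qed.

Lemma omit_arg_fconsS n x (v : {ffun 'I_n.+1 -> T}) i :
  omit_arg (lift ord0 i) (fcons x v) = fcons x (omit_arg i v).
Proof.
apply: eq_fcons => [|k]; rewrite ffunE.
  by rewrite (_ : lift _ _ = ord0) ?fcons0 //; apply: val_inj.
rewrite (_ : lift _ _ = lift ord0 (lift i k)) ?fconsS ?ffunE //.
by apply: val_inj; rewrite /= /bump /= !add1n ltnS addnS.
Qed.

End FinfunCons.

Lemma nth_bracket0 (L : zmodType) n (b x : L) (v : {ffun 'I_n.+1 -> L}) j :
  [ffun k : 'I_n.+1 => nth 0 (b :: [seq (fcons x v) l | l <- enum 'I_n.+2 &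
     (l != ord0) && (l != lift ord0 j)]) k] = fcons b (omit_arg j v).
Proof.
apply: eq_fcons => [|k]; rewrite ffunE //= ffunE.
rewrite enum_ordSl /= filter_map -map_comp.
under eq_filter do rewrite /= (inj_eq lift_inj).
rewrite add0n filter_enum_lift (nth_map j) ?size_map -?enumT ?size_enum_ord //=.
by rewrite (nth_map k) ?size_enum_ord // nth_ord_enum fconsS.
Qed.

Lemma filter_fconsS (L : zmodType) n (x : L) (v : {ffun 'I_n.+1 -> L}) i j :
  [seq (fcons x v) l | l <- enum 'I_n.+2 & (l != lift ord0 i) && (l != lift ord0 j)] =
  x :: [seq v l | l <- enum 'I_n.+1 & (l != i) && (l != j)].
Proof.
rewrite enum_ordSl /= fcons0 filter_map -map_comp; congr (_ :: _).
under eq_filter do rewrite /= !(inj_eq lift_inj).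
by apply: eq_map => k /=; rewrite fconsS.
Qed.

Lemma sum_pairs_recl (M : zmodType) n (G : 'I_n.+1 -> 'I_n.+1 -> M) :
  \sum_(i < n.+1) \sum_(j < n.+1 | (i < j)%N) G i j =
  \sum_(j < n) G ord0 (lift ord0 j) +
  \sum_(i < n) \sum_(j < n | (i < j)%N) G (lift ord0 i) (lift ord0 j).
Proof.
rewrite big_ord_recl; congr (_ + _).
  by rewrite big_mkcond big_ord_recl /= add0r.
by apply: eq_bigr => i _; rewrite big_mkcond big_ord_recl /= add0r -big_mkcond.
Qed.

Section Contraction.
Variables (F : fieldType) (L : lieAlgType F) (M : lmodType F).
Variable rho : lieAction L M.
Implicit Types (x y : L).

Definition contract n x (f : {ffun 'I_n.+1 -> L} -> M) (v : {ffun 'I_n -> L}) : M :=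
  f (fcons x v).

Lemma fcons_set_arg n x y (v : {ffun 'I_n -> L}) : fcons x v = set_arg (fcons y v) ord0 x.
Proof.
apply/esym/eq_fcons => [|k]; first by rewrite ffunE eqxx.
by rewrite ffunE eq_sym (negPf (neq_lift _ _)) fconsS.
Qed.

Lemma set_arg_fcons n x y (v : {ffun 'I_n -> L}) i :
  fcons x (set_arg v i y) = set_arg (fcons x v) (lift ord0 i) y.
Proof.
apply/esym/eq_fcons => [|k]; first by rewrite ffunE (negPf (neq_lift _ _)) fcons0.
by rewrite !ffunE (inj_eq lift_inj) liftK.
Qed.

Lemma contract_linear n (f : {ffun 'I_n.+1 -> L} -> M) v : multilinear f ->
  linear (fun x => contract x f v).
Proof.
move=> fl a x y; have E z := fcons_set_arg z 0 v.
by rewrite /contract (E (_ + _)) (E x) (E y); exact: fl.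
Qed.

Lemma contract_multilinear n x (f : {ffun 'I_n.+1 -> L} -> M) :
  multilinear f -> multilinear (contract x f).
Proof.
by move=> fl v i a y z; rewrite /contract !set_arg_fcons; apply: fl.
Qed.

Lemma contract_alternating n x (f : {ffun 'I_n.+1 -> L} -> M) :
  alternating f -> alternating (contract x f).
Proof.
move=> fa v i j ij vij; apply: (fa _ (lift ord0 i) (lift ord0 j)).
  by rewrite (inj_eq lift_inj).
by rewrite !fconsS.
Qed.

Lemma alternating_swap n (f : {ffun 'I_n.+2 -> L} -> M) x y v :
  multilinear f -> alternating f -> f (fcons x (fcons y v)) = - f (fcons y (fcons x v)).
Proof.
move=> fl fa; apply/eqP; rewrite -addr_eq0.
have fD a a' w : f (fcons (a + a') w) = f (fcons a w) + f (fcons a' w).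
  by have := contract_linear w fl 1 a a'; rewrite /contract !scale1r.
have fD' a a' b w : f (fcons b (fcons (a + a') w)) =
    f (fcons b (fcons a w)) + f (fcons b (fcons a' w)).
  by have := contract_linear w (contract_multilinear b fl) 1 a a'; rewrite /contract !scale1r.
have faa a w : f (fcons a (fcons a w)) = 0.
  by apply: (fa _ ord0 (lift ord0 ord0)) => //; rewrite fconsS !fcons0.
have := faa (x + y) v; rewrite fD !fD' !faa add0r addr0 => /eqP.
exact.
Qed.

(** Cartan's formula for the Lie derivative, with the contraction of the
    differential isolated on one side.  In the sum over pairs of arguments,
    the pairs that contain x give the brackets of x with the other arguments;
    in the remaining pairs the bracket comes before x, and moving x to the
    front costs the sign of the last term. *)
Lemma CE_diff_fcons n (f : {ffun 'I_n.+1 -> L} -> M) x (v : {ffun 'I_n.+1 -> L}) :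
  multilinear f -> alternating f ->
  CE_diff rho f (fcons x v) =
    rho x (f v) - \sum_(i < n.+1) (-1) ^+ i *: f (fcons (bracket x (v i)) (omit_arg i v))
    - CE_diff rho (contract x f) v.
Proof.
move=> fl fa; rewrite /CE_diff sum_pairs_recl big_ord_recl expr0 scale1r fcons0.
rewrite -/(omit_arg _ _) omit_arg_fcons0 opprD -!addrA; congr (_ + _).
rewrite [RHS]addrCA; congr (_ + _); last congr (_ + _).
- rewrite -sumrN; apply: eq_bigr => i _.
  by rewrite fconsS -/(omit_arg _ _) omit_arg_fconsS exprS mulN1r scaleNr.
- rewrite -sumrN; apply: eq_bigr => j _.
  by rewrite nth_bracket0 fconsS add0n exprS mulN1r scaleNr.
rewrite -sumrN; apply: eq_bigr => i _; rewrite -sumrN; apply: eq_bigr => j ij.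
rewrite !fconsS filter_fconsS -scalerN.
have -> : (-1) ^+ (lift ord0 i + lift ord0 j) = (-1) ^+ (i + j) :> F.
  by rewrite /= /bump !add1n addnS !exprS !mulN1r opprK.
congr (_ *: _); case: n f fl fa v i j ij => [|m] f fl fa v i j ij.
  by move: ij; rewrite !ord1.
set r := [seq v l | l <- _ & _]; set b := bracket _ _.
have nthE y z : [ffun k : 'I_m.+2 => nth 0 (y :: z :: r) k] =
    fcons y (fcons z [ffun k : 'I_m => nth 0 r k]).
  apply: eq_fcons => [|k]; first by rewrite ffunE.
  rewrite ffunE /=; case: (unliftP ord0 k) => [k' ->|->]; last by rewrite fcons0.
  by rewrite fconsS ffunE.
rewrite nthE alternating_swap // /contract; congr (- f (fcons _ _)).
apply/esym/eq_fcons => [|k]; rewrite ffunE //.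
by rewrite ffunE.
Qed.

End Contraction.

(** * Vanishing from an invariant tensor *)

(** The family (e, A) plays the part of the invariant tensor sum e_i (x) A_i,
    with A_i acting on the module; its invariance is tested on linear maps psi
    from the Lie algebra to the module, which will be cochains with all but one
    argument fixed. *)
Section Homotopy.
Variables (F : fieldType) (L : lieAlgType F) (M : lmodType F).
Variables (rho : lieAction L M).
Variables (I : Type) (r : seq I) (e : I -> L) (A : I -> {linear M -> M}).

Hypothesis invariantA : forall (psi : L -> M) (y : L), linear psi ->
  \sum_(i <- r) (A i (rho y (psi (e i))) - rho y (A i (psi (e i)))
                 + A i (psi (bracket (e i) y))) = 0.

HB.instance Definition _ x := GRing.isLinear.Build F M M _ (rho x) (lie_act_linearr rho x).

Definition casimir_act (m : M) : M := \sum_(i <- r) A i (rho (e i) m).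

Definition homotopy n (f : {ffun 'I_n.+1 -> L} -> M) (v : {ffun 'I_n -> L}) : M :=
  \sum_(i <- r) A i (contract (e i) f v).

(** Invariance of the tensor for psi the evaluation of the action at m. *)
Lemma casimir_actC y m : casimir_act (rho y m) = rho y (casimir_act m).
Proof.
apply/eqP; rewrite -subr_eq0; apply/eqP.
rewrite -[RHS](invariantA y (lie_act_linearl rho m)) linear_sum -sumrB.
apply: eq_bigr => i _; rewrite lie_act_bracket linearB /=.
by rewrite [RHS]addrC addrA subrK.
Qed.

Lemma homotopy_cochain n (f : {ffun 'I_n.+1 -> L} -> M) :
  multilinear f -> alternating f -> homotopy f \in @cochain_pred F L M n.
Proof.
move=> fl fa; apply/asboolP; split.
  move=> v i a x y; rewrite /homotopy scaler_sumr -big_split; apply: eq_bigr => j _.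
  by rewrite (contract_multilinear _ fl) linearP.
move=> v i j ij vij; rewrite /homotopy big1 // => k _.
by rewrite (contract_alternating _ fa ij vij) linear0.
Qed.

(** Apply A_i to the vanishing differential of f at (e_i, v) and sum over i.
    By [CE_diff_fcons] this differs from the asserted identity, for each k, by
    the invariance of the tensor with psi x = f(x, v without v_k). *)
Theorem CE_diff_homotopy n (f : {ffun 'I_n.+1 -> L} -> M) v :
    multilinear f -> alternating f -> CE_diff rho f = 0 ->
  CE_diff rho (homotopy f) v = casimir_act (f v).
Proof.
move=> fl fa df0.
have key i : A i (rho (e i) (f v)) =
    \sum_(k < n.+1) (-1) ^+ k *: A i (contract (bracket (e i) (v k)) f (omit_arg k v))
    + A i (CE_diff rho (contract (e i) f) v).
  have := CE_diff_fcons rho (e i) v fl fa; rewrite df0 /= => /esym/eqP.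
  rewrite -addrA -opprD subr_eq0 => /eqP ->; rewrite linearD linear_sum /=.
  by congr (_ + _); apply: eq_bigr => k _; rewrite linearZ.
rewrite /casimir_act (eq_bigr _ (fun i _ => key i)) big_split /=.
under [X in _ + X]eq_bigr do rewrite /CE_diff linearD /=.
rewrite big_split /= addrA; congr (_ + _); last first.
  rewrite /homotopy; under [RHS]eq_bigr do rewrite linear_sum.
  rewrite [RHS]exchange_big; apply: eq_bigr => k _ /=.
  under [RHS]eq_bigr do rewrite linear_sum.
  rewrite [RHS]exchange_big; apply: eq_bigr => l _ /=.
  by rewrite scaler_sumr; apply: eq_bigr => i _; rewrite linearZ.
under [X in _ + X]eq_bigr do rewrite linear_sum.
rewrite exchange_big [X in _ + X]exchange_big -big_split; apply: eq_bigr => k _ /=.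
rewrite -[[ffun _ => _]]/(omit_arg k v) /homotopy.
under [X in _ + X]eq_bigr do rewrite linearZ.
rewrite -!scaler_sumr -scalerDr; congr (_ *: _); rewrite linear_sum -big_split.
apply/eqP; rewrite -subr_eq0 -oppr_eq0 opprB; apply/eqP.
rewrite -[RHS](invariantA (v k) (contract_linear (omit_arg k v) fl)) -sumrB.
by apply: eq_bigr => i _ /=; rewrite [RHS]addrC addrA.
Qed.

(** The inverse D of the Casimir operator commutes with the action, so D f is a
    cocycle along with f, and the homotopy applied to D f is a primitive of
    f. *)
Theorem cohomology_eq0 : bijective casimir_act ->
  forall n (c : cohomology rho n.+1), c = 0.
Proof.
case=> D CD DC n c; elim/quotW: c => z.
have casL : linear casimir_act.
  move=> a u v; rewrite /casimir_act scaler_sumr -big_split; apply: eq_bigr => i _.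
  by rewrite !linearP.
have DL : linear D.
  by move=> a u v; apply: (can_inj CD); rewrite casL !DC.
have DR y m : D (rho y m) = rho y (D m).
  by apply: (can_inj CD); rewrite casimir_actC !DC.
have D0 : D 0 = 0 by have := zmod_morphism_linear DL 0 0; rewrite !subrr.
have /asboolP[fl fa] := valP (val z).
have /asboolP df0 := valP z.
set f := cochain_fun _ in fl fa df0.
have gl : multilinear (D \o f) by move=> v i a x y; rewrite /= -DL; congr D; exact: fl.
have ga : alternating (D \o f) by move=> v i j ij vij; rewrite -D0; congr D; exact: fa ij vij.
have dg0 : CE_diff rho (D \o f) = 0.
  apply/funext=> v; transitivity (D (CE_diff rho f v)); last by rewrite df0.
  have [D' DE] : exists D' : {linear M -> M}, D = D'.
    pose D' : {linear M -> M} := HB.pack D (GRing.isLinear.Build F M M _ D DL).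
    by exists D'.
  rewrite DE /CE_diff linearD !linear_sum /=; congr (_ + _).
    by apply: eq_bigr => i _; rewrite linearZ /= -DE -DR.
  apply: eq_bigr => i _; rewrite linear_sum; apply: eq_bigr => j _.
  by rewrite linearZ.
apply/eqP; rewrite -[0](raddf0 (\pi_(cohomology rho n.+1))); apply/eqP.
apply/quot_eqP; rewrite subr0; apply/asboolP.
exists (Cochain (homotopy_cochain gl ga)); apply/funext=> v /=.
by rewrite CE_diff_homotopy //= DC.
Qed.

End Homotopy.

Lemma cohomology_of_zero_algebra (F : fieldType) (L : lieAlgType F) (M : lmodType F)
    (rho : lieAction L M) : (forall x : L, x = 0) ->
  forall n (c : cohomology rho n.+1), c = 0.
Proof.
move=> L0 n c; elim/quotW: c => z.
apply/eqP; rewrite -[0](raddf0 (\pi_(cohomology rho n.+1))); apply/eqP.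
apply/quot_eqP; rewrite subr0; apply/asboolP; exists 0.
have /asboolP[fl _] := valP (val z); apply/funext=> v.
rewrite [LHS](congr1 (fun f => f v) (CE_diff0 rho n)).
have := fl v ord0 (-1) 0 0; rewrite /= scaler0 addr0 scaleN1r addNr => fv0.
rewrite -[LHS]fv0; congr (_ _).
by apply/ffunP=> k; rewrite [LHS]L0 [RHS]L0.
Qed.

(** * The matrix Lie algebra of an irreducible action *)

Section MatrixModel.
Variables (F : fieldType) (L : finLieAlgType F) (S : vectType F).
Variables (rho : lieAction L S) (irr : irreducible rho).

(** Coordinates in a space of positive dimension, which square matrices need
    in order to form a ring. *)
Lemma row_model : exists N (f : S -> 'rV[F]_N.+1) (g : 'rV[F]_N.+1 -> S),
  [/\ linear f, linear g, cancel f g & cancel g f].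
Proof.
have [f [g fgP]] : exists (f : S -> 'rV[F]_(dim S)) (g : 'rV[F]_(dim S) -> S),
    [/\ linear f, linear g, cancel f g & cancel g f].
  exists v2r, r2v; split; [exact: linearP | exact: linearP | exact: v2rK | exact: r2vK].
case: (dim S) f g fgP => [|N] f g fgP; last by exists N, f, g.
have [_ _ fK _] := fgP; case: irr => /eqP[]; apply/vspaceP=> u.
rewrite memvf memv0; apply/esym/eqP/(can_inj fK).
by rewrite [LHS]thinmx0 [RHS]thinmx0.
Qed.

Section Model.
Variables (N : nat) (f : S -> 'rV[F]_N.+1) (g : 'rV[F]_N.+1 -> S).
Hypotheses (fL : linear f) (gL : linear g) (fK : cancel f g) (gK : cancel g f).
Local Notation Q := (lie_quotient (annihilator rho)).
Local Notation A := 'M[F]_N.+1.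

(** Matrices act on rows from the right, so this is an anti-homomorphism to
    the Lie algebra of matrices. *)
Definition act_mx (x : L) : A := \matrix_i f (rho x (g (delta_mx 0 i))).

Lemma act_mxE x u : f (rho x u) = f u *m act_mx x.
Proof.
rewrite -{1}[u]fK {1}[f u]row_sum_delta mulmx_sum_row.
rewrite (linear_comb gL) (linear_comb (lie_act_linearr rho x)) (linear_comb fL).
by apply: eq_bigr => i _; rewrite rowK.
Qed.

Lemma act_mx_linear : linear act_mx.
Proof.
move=> a x y; apply/row_matrixP=> i; rewrite linearP /= !rowK.
by rewrite lie_act_linearl fL.
Qed.

Lemma eq_act_mx (C D : A) : (forall u, f u *m C = f u *m D) -> C = D.
Proof.
by move=> CD; apply/row_matrixP=> i; rewrite !rowE -[delta_mx _ _]gK.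
Qed.

Lemma act_mx_bracket x y : act_mx (bracket x y) = commutator (act_mx y) (act_mx x).
Proof.
apply: eq_act_mx => u; rewrite -act_mxE lie_act_bracket (zmod_morphism_linear fL).
by rewrite !act_mxE /commutator mulmxBr -!mulmxE !mulmxA.
Qed.

Lemma pi_eq x y : act_mx x = act_mx y -> \pi_Q x = \pi_Q y.
Proof.
move=> xy; apply/lie_quot_eqP/annihilatorP=> m.
rewrite (zmod_morphism_linear (lie_act_linearl rho m)) /=.
by apply/eqP; rewrite subr_eq0 -[rho x m]fK -[rho y m]fK !act_mxE xy.
Qed.

HB.instance Definition _ := GRing.isLinear.Build F L A _ act_mx act_mx_linear.

Let G := limg (linfun act_mx).

Lemma act_mxG x : act_mx x \in G.
Proof. by rewrite -(lfunE (act_mx : {linear _ -> _})) memv_img ?memvf. Qed.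

(** Linear on all matrices, which allows it to enter the bilinear maps that
    test invariance of a tensor. *)
Definition lift_mx (a : A) : L := ((linfun act_mx)^-1)%VF a.

Lemma lift_mxK a : a \in G -> act_mx (lift_mx a) = a.
Proof. by move=> aG; rewrite -(lfunE (act_mx : {linear _ -> _})) limg_lfunVK. Qed.

Lemma memGP a : reflect (exists x, a = act_mx x) (a \in G).
Proof.
by apply: (iffP idP) => [aG|[x ->]]; [exists (lift_mx a); rewrite lift_mxK|exact: act_mxG].
Qed.

Lemma G_comm x y : x \in G -> y \in G -> commutator x y \in G.
Proof. by move=> /memGP[a ->] /memGP[b ->]; rewrite -act_mx_bracket act_mxG. Qed.

(** Subspaces of rows stable under G correspond to submodules of S. *)
Lemma G_irr (U : {vspace 'rV[F]_N.+1}) : stable_under G U -> U = 0%VS \/ U = fullv.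
Proof.
move=> stU; have [||U' U'P] := @vspace_of_pred _ S (fun u => f u \in U).
- by rewrite -(subrr 0) (zmod_morphism_linear fL) subrr mem0v.
- by move=> a u v uU vU; rewrite fL memvD ?memvZ.
have gU w : (w \in U) = (g w \in U').
  by apply/idP/idP => [wU|/U'P]; [apply/U'P; rewrite gK|rewrite gK].
have [x u /U'P uU||] := irr.2 U'.
- by apply/U'P; rewrite act_mxE stU // act_mxG.
- move=> U'0; left; apply/vspaceP=> w; rewrite gU U'0 !memv0.
  apply/eqP/eqP => [gw|->]; last by rewrite -(subrr 0) (zmod_morphism_linear gL) subrr.
  by rewrite -[w]gK gw -(subrr 0) (zmod_morphism_linear fL) subrr.
by move=> U'f; right; apply/vspaceP=> w; rewrite gU U'f !memvf.
Qed.

Lemma quot_eq0 : G = 0%VS -> forall q : Q, q = 0.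
Proof.
move=> G0; elim/quotW=> x; rewrite -(raddf0 (\pi_Q)); apply: pi_eq.
by have := act_mxG x; have := act_mxG 0; rewrite G0 !memv0 => /eqP-> /eqP->.
Qed.

Let right_mul (D : A) (u : S) : S := g (f u *m D).

Let right_mul_linear D : linear (right_mul D).
Proof. by move=> a u v; rewrite /right_mul fL mulmxDl -scalemxAl gL. Qed.

HB.instance Definition _ D := GRing.isLinear.Build F S S _ (right_mul D) (right_mul_linear D).

(** Transport an invariant tensor of matrices: first factors lift to the
    quotient Lie algebra and second factors act on S.  A pair p acts by
    p.1 first, then p.2, which in row convention is the product p.1 * p.2. *)
Theorem model_cohomology_eq0 : [pchar F] =i pred0 ->
  forall n (c : cohomology (quot_action rho) n.+1), c = 0.
Proof.
move=> charF n c; have [G0|G0] := eqVneq G 0%VS.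
  by apply: cohomology_of_zero_algebra; exact: quot_eq0.
have [s sP] := exists_invariant_tensor charF G_comm G_irr G0.
have CU := invariant_tensor_unit G_irr sP.
case: sP => sG _ inv.
have qactE x u : quot_action rho (\pi_Q x) u = rho x u by exact: quot_actE.
pose e (p : A * A) : Q := \pi_Q (lift_mx p.1).
apply: (@cohomology_eq0 _ _ _ _ _ s e (fun p => right_mul p.2 : {linear S -> S})).
  move=> psi; elim/quotW=> y psiL.
  have := inv S (fun a b => right_mul b (psi (\pi_Q (lift_mx a)))) _ _ _ (act_mxG y).
  rewrite big_seq => inv0; rewrite -[RHS]inv0; last 2 first.
  - move=> b k a a'; rewrite /lift_mx linearP.
    by rewrite (lie_pi_linear (annihilator rho)) psiL right_mul_linear.
  - by move=> a k b b'; rewrite /right_mul mulmxDr -scalemxAr gL.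
  rewrite big_seq; apply: eq_bigr => p /sG pG; rewrite !qactE addrC; congr (_ + _).
    congr (right_mul _ (psi _)); rewrite -[bracket _ _]pi_bracket; apply: pi_eq.
    by rewrite act_mx_bracket !lift_mxK // G_comm // act_mxG.
  rewrite /= /right_mul /commutator mulmxBr (zmod_morphism_linear gL) act_mxE.
  congr (_ - _); first by rewrite -mulmxE mulmxA.
  by apply: (can_inj fK); rewrite act_mxE !gK -mulmxE mulmxA.
set C := \sum_(p <- s) _ in CU.
have casE u : casimir_act (quot_action rho) s e (fun p => right_mul p.2) u = right_mul C u.
  rewrite /right_mul mulmx_sumr.
  under [in RHS]eq_bigr do rewrite -[_ *m _]scale1r.
  rewrite (linear_comb gL) /casimir_act big_seq [RHS]big_seq.
  apply: eq_bigr => p /sG pG; rewrite scale1r.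
  rewrite -[LHS]/(right_mul p.2 (quot_action rho (\pi_Q (lift_mx p.1)) u)) qactE.
  rewrite /right_mul act_mxE lift_mxK //.
  by rewrite -mulmxE mulmxA.
exists (right_mul (invmx C)) => u; rewrite casE /right_mul gK.
  by rewrite -mulmxA mulmxV // mulmx1 fK.
by rewrite -mulmxA mulVmx // mulmx1 fK.
Qed.

End Model.
End MatrixModel.

(** * Vanishing of the cohomology *)

Theorem corollary3p2 (F : fieldType) (charF : [pchar F] =i pred0)
    (L : finLieAlgType F) (S : vectType F) (rho : lieAction L S)
    (irr : irreducible rho) (n : nat) (n_gt0 : (0 < n)%N)
    (c : cohomology (quot_action rho) n) : c = 0.
Proof.
case: n n_gt0 c => // n _ c.
have [N [f [g [fL gL fK gK]]]] := row_model irr.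
exact: (model_cohomology_eq0 irr fL gL fK gK charF).
Qed.
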